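(* Let $w=y_1\ldots y_k$ and $v=x_1\ldots x_n$ be non-empty words over $\{0,1\}$ with $y_k\ne x_n$, and let $G=\mathfrak{K}(w,v)$. \begin{enumerate} \item If $k\ge2$ and $n\ge2$, or if $k\ge3$ and $n=1$, then $G$ is branch on $G'$; we have $G/G'\cong(\mathbb{Z}/2\mathbb{Z})^{k+n}$, generated by the images of the $a_i,b_j$, and $G'/(G'\times G')\cong(\mathbb{Z}/2\mathbb{Z})^{k+n-1}$, generated by the images of $[b_1,b_j]$ ($2\le j\le k$) and $[b_1,a_i]$ ($1\le i\le n$). \item If $k=2$ and $n=1$, then $G$ is branch on $L=\langle[b_1,b_2a_1]\rangle^{G}$; we have $G'/L\cong(\mathbb{Z}/2\mathbb{Z})^2$, generated by the images of $[b_1,b_2]$ and $[b_2,a_1]$. Set $x=[b_1,b_2a_1]$; then $L/(L\times L)\cong\mathbb{Z}/4\mathbb{Z}\times\mathbb{Z}/2\mathbb{Z}$, generated by the images of $x$ and $x^{a_1}$, with the relations $x^4=(x^{a_1})^4=x^2(x^{2})^{a_1}=1$. \item If $k=1$ and $n\ge2$, then $G$ is branch on $L=\langle[a_i,a_j]\ (1\le i<j\le n),\ [a_i,b_1]\ (1\le i<n)\rangle^{G}$; we have $G'/L\cong\mathbb{Z}/2\mathbb{Z}$, generated by the image of $[a_n,b_1]$, and $L/(L\times L)\cong\mathbb{Z}/4\mathbb{Z}\times(\mathbb{Z}/2\mathbb{Z})^{n-2}$, generated by the images of $[a_i,b_1]$ ($1\le i<n$), where $[a_1,b_1]$ has order $4$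 and the other generators have order $2$. \item If $k=n=1$, then $G$ is infinite dihedral, and is not even weakly branch. \end{enumerate}
   Context: $[a,b]=a^{-1}b^{-1}ab$, $a^b=b^{-1}ab$, $G'$ is the derived subgroup, and $\langle S\rangle^G$ denotes the normal closure of $S$ in $G$. Automorphisms of the binary rooted tree $\{0,1\}^*$ act on the right. $\langle\langle g_0,g_1\rangle\rangle$ denotes the automorphism $0u\mapsto0u^{g_0}$, $1u\mapsto1u^{g_1}$; $\sigma$ exchanges $0$ and $1$ in the first letter; $\langle\langle g_0,g_1\rangle\rangle\sigma$ means first apply $\langle\langle g_0,g_1\rangle\rangle$, then $\sigma$. $\mathfrak{K}(w,v)$ is the subgroup of $\mathrm{Aut}(\{0,1\}^* )$ generated by $b_1,\dots,b_k,a_1,\dots,a_n$, where $b_1=\sigma$; for $1\le j<k$, $b_{j+1}=\langle\langle b_j,1\rangle\rangle$ if $y_j=0$ and $\langle\langle1,b_j\rangle\rangle$ if $y_j=1$; $a_1=\langle\langle b_k,a_n\rangle\rangle$ if $y_k=0,x_n=1$ and $a_1=\langle\langle a_n,b_k\rangle\rangle$ if $y_k=1,x_n=0$; for $1\le i<n$, $a_{i+1}=\langle\langle a_i,1\rangle\rangle$ if $x_i=0$ and $\langle\langle1,a_i\rangle\rangle$ if $x_i=1$. For $H\le\mathrm{Aut}(\{0,1\}^* )$, $H\times H$ denotes the geometric direct product $\{\langle\langle h_0,h_1\rangle\rangle:h_0,h_1\in H\}\le\mathrm{Aut}(\{0,1\}^* )$. A group $G\le\mathrm{Aut}(\{0,1\}^*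 )$ is (regular) weakly branch on $H\le G$ if $H$ is non-trivial and $H\times H\le H$; it is (regular) branch on $H$ if moreover $H$ has finite index in $G$; it is weakly branch if it is weakly branch on some subgroup. *)

(* Defs.v *)
From HB Require Import structures.
From mathcomp Require Import all_boot all_order all_algebra.
From mathcomp Require Import all_classical.

Set Implicit Arguments.
Unset Strict Implicit.
Unset Printing Implicit Defensive.

Local Open Scope classical_set_scope.
Local Open Scope group_scope.

(******************************************************************************)
(* Subgroups and quotients of arbitrary (possibly infinite) groups.           *)
(* Conjugation x ^ y = y^-1 * x * y and commutators                           *)
(* [~ x, y] = x^-1 * y^-1 * x * y are those of MathComp.                      *)
(******************************************************************************)

Identity Coercion fun_of_set : set >-> Funclass.

Record subgroup (T : groupType) := Subgroup {
  sgset :> set T;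
  sg1 : sgset 1;
  sgM : forall x y, sgset x -> sgset y -> sgset (x * y);
  sgV : forall x, sgset x -> sgset x^-1 }.

Section Subgroups.
Variable T : groupType.
Implicit Types (S : set T) (G H N : subgroup T).

Definition generated S : subgroup T.
Proof.
exists [set x | forall H, S `<=` H -> H x].
- by move=> H _; exact: sg1.
- by move=> x y Sx Sy H SH; apply: sgM; [exact: Sx | exact: Sy].
- by move=> x Sx H SH; apply: sgV; exact: Sx.
Defined.

Definition der G : subgroup T := generated [set [~ x, y] | x in G & y in G].

Definition normal_closure G S : subgroup T :=
  generated [set s ^ g | s in S & g in G].

Definition rcoset_of S (x : T) : set T := [set s * x | s in S].

Definition finite_index H G := finite_set [set rcoset_of H x | x in G].

Definition normaliser_of S : set T := [set x | forall y, S (y ^ x) <-> S y].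

Definition normal_in N G := N `<=` G /\ G `<=` normaliser_of N.

Definition nontrivial H := exists2 h, H h & h <> 1.

Definition has_order (x : T) (m : nat) :=
  [/\ (0 < m)%N, x ^+ m = 1 & forall j, (0 < j < m)%N -> x ^+ j <> 1].

Definition isomorphic G (Q : groupType) := exists f : T -> Q,
  (forall x y, G x -> G y -> f (x * y) = f x * f y) /\
  set_bij G [set: Q] f.

Lemma normaliser1 S : normaliser_of S 1.
Proof. by move=> y; rewrite conjg1. Qed.

Lemma normaliserM S x y :
  normaliser_of S x -> normaliser_of S y -> normaliser_of S (x * y).
Proof. by move=> nx ny z; rewrite conjgM ny nx. Qed.

Lemma normaliserV S x : normaliser_of S x -> normaliser_of S x^-1.
Proof. by move=> nx z; rewrite -(nx (z ^ x^-1)) conjgKV. Qed.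

Lemma rcoset_of_mul N x y : normaliser_of N x ->
  [set c * d | c in rcoset_of N x & d in rcoset_of N y] = rcoset_of N (x * y).
Proof.
move=> nx; apply/seteqP; split=> z.
  move=> [c [s Ns <-] [d [t Nt <-] <-]].
  exists (s * t ^ x^-1); last by rewrite /conjg invgK !mulgA mulgVK.
  by apply: sgM => //; apply/(normaliserV nx).
move=> [s Ns <-]; exists (s * x); first by exists s.
by exists y; rewrite ?mulgA //; exists 1; rewrite ?mul1g //; exact: sg1.
Qed.

Lemma rcoset_of_inv N x : normaliser_of N x ->
  [set c^-1 | c in rcoset_of N x] = rcoset_of N x^-1.
Proof.
move=> nx; apply/seteqP; split=> z.
  move=> [c [s Ns <-] <-]; exists (s^-1 ^ x).
    by apply/nx; exact: sgV.
  by rewrite /conjg invgM !mulgA mulgK.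
move=> [s Ns <-]; exists ((s^-1 ^ x^-1) * x).
  by exists (s^-1 ^ x^-1) => //; apply/(normaliserV nx); exact: sgV.
by rewrite /conjg invgK !mulgA mulgVK invgM invgK.
Qed.

End Subgroups.

(* As for MathComp's [coset_of], the cosets of N by the elements of its       *)
(* normaliser form a group under set multiplication, for every N.             *)
Section Quotient.
Variables (T : groupType) (N : subgroup T).

Record quot := Quot {
  qset : set T;
  qsetP : exists2 x, normaliser_of N x & qset = rcoset_of N x }.

Lemma quot_inj (A B : quot) : qset A = qset B -> A = B.
Proof.
case: A B => [A pA] [B pB] /= eAB; move: pA pB; rewrite eAB => pA pB.
by rewrite (Prop_irrelevance pA pB).
Qed.

Definition quot_of x (nx : normaliser_of N x) : quot :=
  @Quot (rcoset_of N x) (ex_intro2 _ _ x nx erefl).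

Definition quot1 : quot := quot_of (@normaliser1 T N).

Lemma quotM_subproof (A B : quot) :
  exists2 x, normaliser_of N x &
    [set c * d | c in qset A & d in qset B] = rcoset_of N x.
Proof.
case: (qsetP A) (qsetP B) => [x nx ->] [y ny ->].
by exists (x * y); [exact: normaliserM | rewrite rcoset_of_mul].
Qed.

Definition quotM A B : quot := Quot (quotM_subproof A B).

Lemma quotV_subproof (A : quot) :
  exists2 x, normaliser_of N x & [set c^-1 | c in qset A] = rcoset_of N x.
Proof.
case: (qsetP A) => [x nx ->].
by exists x^-1; [exact: normaliserV | rewrite rcoset_of_inv].
Qed.

Definition quotV A : quot := Quot (quotV_subproof A).

Lemma quotE (A : quot) : exists x (nx : normaliser_of N x), A = quot_of nx.
Proof. by case: (qsetP A) => x nx eA; exists x, nx; exact: quot_inj. Qed.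

Lemma quot_of_eq x y (nx : normaliser_of N x) (ny : normaliser_of N y) :
  x = y -> quot_of nx = quot_of ny.
Proof. by move=> e; apply: quot_inj; rewrite /= e. Qed.

Lemma quotME x y (nx : normaliser_of N x) (ny : normaliser_of N y) :
  quotM (quot_of nx) (quot_of ny) = quot_of (normaliserM nx ny).
Proof. by apply: quot_inj; rewrite /= rcoset_of_mul. Qed.

Lemma quotVE x (nx : normaliser_of N x) :
  quotV (quot_of nx) = quot_of (normaliserV nx).
Proof. by apply: quot_inj; rewrite /= rcoset_of_inv. Qed.

Lemma quotMA : associative quotM.
Proof.
move=> A B C; have [x [nx ->]] := quotE A; have [y [ny ->]] := quotE B.
have [z [nz ->]] := quotE C.
by rewrite !quotME; apply: quot_of_eq; exact: mulgA.
Qed.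

Lemma quotM1l : left_id quot1 quotM.
Proof.
move=> A; have [x [nx ->]] := quotE A.
by rewrite quotME; apply: quot_of_eq; exact: mul1g.
Qed.

Lemma quotM1r : right_id quot1 quotM.
Proof.
move=> A; have [x [nx ->]] := quotE A.
by rewrite quotME; apply: quot_of_eq; exact: mulg1.
Qed.

Lemma quotMV : left_inverse quot1 quotV quotM.
Proof.
move=> A; have [x [nx ->]] := quotE A.
by rewrite quotVE quotME; apply: quot_of_eq; exact: mulVg.
Qed.

Lemma quotMVr : right_inverse quot1 quotV quotM.
Proof.
move=> A; have [x [nx ->]] := quotE A.
by rewrite quotVE quotME; apply: quot_of_eq; exact: mulgV.
Qed.

HB.instance Definition _ := gen_eqMixin quot.
HB.instance Definition _ := gen_choiceMixin quot.
HB.instance Definition _ :=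
  isGroup.Build quot quotMA quotM1l quotM1r quotMV quotMVr.

(* The coset of x; the value 1 outside the normaliser of N is junk. *)
Definition coset_proj (x : T) : quot :=
  if pselect (normaliser_of N x) is left nx then quot_of nx else 1.

Lemma coset_projE x (nx : normaliser_of N x) : coset_proj x = quot_of nx.
Proof. by rewrite /coset_proj; case: pselect => // nx'; apply: quot_of_eq. Qed.

Definition quot_group (G : subgroup T) : subgroup quot.
Proof.
exists [set coset_proj x | x in G `&` normaliser_of N].
- exists 1; first by split; [exact: sg1 | exact: normaliser1].
  exact: coset_projE.
- move=> _ _ [x [Gx nx] <-] [y [Gy ny] <-]; exists (x * y).
    by split; [exact: sgM | exact: normaliserM].
  by rewrite (coset_projE nx) (coset_projE ny)
    (coset_projE (normaliserM nx ny)) -quotME.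
- move=> _ [x [Gx nx] <-]; exists x^-1.
    by split; [exact: sgV | exact: normaliserV].
  by rewrite (coset_projE nx) (coset_projE (normaliserV nx)) -quotVE.
Defined.

End Quotient.

Definition quot_isog (T : groupType) (G N : subgroup T) (Q : groupType) :=
  normal_in N G /\ isomorphic (quot_group N G) Q.

Definition quot_gen_by (T : groupType) (G N : subgroup T) (S : set T) :=
  [/\ normal_in N G, S `<=` G &
      quot_group N G = generated [set coset_proj N s | s in S] :> set (quot N)].

(******************************************************************************)
(* The infinite dihedral group, as the semidirect product of Z by {1, -1}:    *)
(* (m, e) is the isometry z |-> m + (-1)^e z of Z.                            *)
(******************************************************************************)

Definition dihedral_infty := (int * bool)%type.

Section DihedralInfty.
Local Open Scope ring_scope.

Implicit Types x y : dihedral_infty.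

Definition dihM x y : dihedral_infty :=
  (x.1 + (-1) ^+ x.2 * y.1, x.2 (+) y.2).
Definition dih1 : dihedral_infty := (0, false).
Definition dihV x : dihedral_infty := (- ((-1) ^+ x.2 * x.1), x.2).

Lemma dihMA : associative dihM.
Proof.
move=> [m e] [n f] [p g]; rewrite /dihM /= addbA; congr (_, _).
by rewrite GRing.mulrDr GRing.addrA GRing.mulrA GRing.signr_addb.
Qed.

Lemma dihM1l : left_id dih1 dihM.
Proof. by case=> m e; rewrite /dihM /= GRing.expr0 GRing.mul1r GRing.add0r. Qed.

Lemma dihM1r : right_id dih1 dihM.
Proof. by case=> m e; rewrite /dihM /= GRing.mulr0 GRing.addr0 addbF. Qed.

Lemma dihMV : left_inverse dih1 dihV dihM.
Proof. by case=> m e; rewrite /dihM /dihV /= GRing.addNr addbb. Qed.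

Lemma dihMVr : right_inverse dih1 dihV dihM.
Proof.
case=> m e; rewrite /dihM /dihV /= addbb GRing.mulrN GRing.mulrA.
by rewrite -GRing.signr_addb addbb GRing.expr0 GRing.mul1r GRing.subrr.
Qed.

HB.instance Definition _ := Choice.on dihedral_infty.
HB.instance Definition _ :=
  isGroup.Build dihedral_infty dihMA dihM1l dihM1r dihMV dihMVr.

End DihedralInfty.

(******************************************************************************)
(* Automorphisms of the binary rooted tree {0,1}^*, with false = 0 and        *)
(* true = 1: the bijections of the set of finite words that preserve the      *)
(* ancestor (prefix) relation. They act on the right, so g * h applies g      *)
(* first.                                                                     *)
(******************************************************************************)

Record treeAut := TreeAut {
  tact :> seq bool -> seq bool;
  tinv : seq bool -> seq bool;
  tactK : cancel tact tinv;
  tinvK : cancel tinv tact;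
  tact_prefix : forall u u', prefix (tact u) (tact u') = prefix u u' }.

Lemma treeAut_eq (g h : treeAut) : (forall u, g u = h u) -> g = h.
Proof.
case: g h => [g gi gK giK gp] [h hi hK hiK hp] /= /funext e.
move: gK giK gp hK hiK hp; rewrite e => gK giK gp hK hiK hp.
have ei : gi = hi by apply/funext => u; rewrite -{1}(hiK u) gK.
move: gK giK hK hiK; rewrite ei => gK giK hK hiK.
by congr TreeAut; exact: Prop_irrelevance.
Qed.

Definition tree1 : treeAut :=
  @TreeAut id id (fun=> erefl) (fun=> erefl) (fun _ _ => erefl).

Definition treeM (g h : treeAut) : treeAut.
Proof.
exists (h \o g) (tinv g \o tinv h).
- by move=> u; rewrite /= !tactK.
- by move=> u; rewrite /= !tinvK.
- by move=> u u'; rewrite /= !tact_prefix.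
Defined.

Definition treeV (g : treeAut) : treeAut.
Proof.
exists (tinv g) g.
- exact: tinvK.
- exact: tactK.
- by move=> u u'; rewrite -(tact_prefix g) !tinvK.
Defined.

Lemma treeMA : associative treeM. Proof. by move=> *; exact: treeAut_eq. Qed.
Lemma treeM1l : left_id tree1 treeM. Proof. by move=> *; exact: treeAut_eq. Qed.
Lemma treeM1r : right_id tree1 treeM. Proof. by move=> *; exact: treeAut_eq. Qed.
Lemma treeMV : left_inverse tree1 treeV treeM.
Proof. by move=> g; apply: treeAut_eq => u; exact: tinvK. Qed.
Lemma treeMVr : right_inverse tree1 treeV treeM.
Proof. by move=> g; apply: treeAut_eq => u; exact: tactK. Qed.

HB.instance Definition _ := gen_eqMixin treeAut.
HB.instance Definition _ := gen_choiceMixin treeAut.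
HB.instance Definition _ :=
  isGroup.Build treeAut treeMA treeM1l treeM1r treeMV treeMVr.

Definition pair_fun (g0 g1 : seq bool -> seq bool) (u : seq bool) :=
  if u is c :: u' then c :: (if c then g1 u' else g0 u') else [::].

(* <<g0, g1>> *)
Definition tpair (g0 g1 : treeAut) : treeAut.
Proof.
exists (pair_fun g0 g1) (pair_fun (tinv g0) (tinv g1)).
- by case=> [|[] u] //=; rewrite tactK.
- by case=> [|[] u] //=; rewrite tinvK.
- by case=> [|[] u] [|[] u'] //=; rewrite tact_prefix.
Defined.

Definition swap_fun (u : seq bool) := if u is c :: u' then ~~ c :: u' else [::].

Definition sigma : treeAut.
Proof.
by exists swap_fun swap_fun;
  [case=> [|[]] | case=> [|[]] | case=> [|[] u] [|[] u']].
Defined.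

Lemma tpair1 : tpair 1 1 = 1.
Proof. by apply: treeAut_eq => -[|[]]. Qed.

Lemma tpairM g0 g1 h0 h1 :
  tpair g0 g1 * tpair h0 h1 = tpair (g0 * h0) (g1 * h1).
Proof. by apply: treeAut_eq => -[|[]]. Qed.

Lemma tpairV g0 g1 : (tpair g0 g1)^-1 = tpair g0^-1 g1^-1.
Proof. by apply: treeAut_eq => -[|[]]. Qed.

Definition geom_prod (H K : subgroup treeAut) : subgroup treeAut.
Proof.
exists [set tpair h k | h in H & k in K].
- by exists 1; [exact: sg1 | exists 1; [exact: sg1 | exact: tpair1]].
- move=> _ _ [h Hh [k Kk <-]] [h' Hh' [k' Kk' <-]].
  exists (h * h'); first exact: sgM.
  by exists (k * k'); [exact: sgM | rewrite tpairM].
- move=> _ [h Hh [k Kk <-]]; exists h^-1; first exact: sgV.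
  by exists k^-1; [exact: sgV | rewrite tpairV].
Defined.

Definition weakly_branch_on (G H : subgroup treeAut) :=
  [/\ H `<=` G, nontrivial H & geom_prod H H `<=` H].

Definition branch_on (G H : subgroup treeAut) :=
  weakly_branch_on G H /\ finite_index H G.

Definition weakly_branch (G : subgroup treeAut) :=
  exists H, weakly_branch_on G H.

(******************************************************************************)
(* The group K(w, v), for w = y_1 ... y_k and v = x_1 ... x_n. All indices    *)
(* are shifted to start from 0: b_{j+1} is [kb w j], a_{i+1} is [ka w v i],   *)
(* y_{j+1} is [nth false w j] and x_{i+1} is [nth false v i].                 *)
(******************************************************************************)

Fixpoint kb (w : seq bool) (j : nat) : treeAut :=
  if j is j'.+1 then
    if nth false w j' then tpair 1 (kb w j') else tpair (kb w j') 1
  else sigma.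

(* The a_i are mutually recursive; their action on words is defined by        *)
(* recursion on the word, with g the action of b_k. The equations defining    *)
(* the a_i are the lemmas ka0 and kaS below.                                  *)
Fixpoint ka_fun (g : seq bool -> seq bool) (v : seq bool) (i : nat)
    (u : seq bool) : seq bool :=
  if u is c :: u' then
    c :: (if i is i'.+1 then
            if c == nth false v i' then ka_fun g v i' u' else u'
          else if c == last false v then ka_fun g v (size v).-1 u' else g u')
  else [::].

Lemma ka_funK g h v i : cancel g h -> cancel (ka_fun g v i) (ka_fun h v i).
Proof.
move=> gK u; elim: u i => [|c u IHu] [|i] //=; congr cons.
  by case: (c == last false v); rewrite ?IHu ?gK.
by case: (c == nth false v i); rewrite ?IHu.
Qed.

Lemma ka_fun_prefix g v i :
  (forall u u', prefix (g u) (g u') = prefix u u') ->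
  forall u u', prefix (ka_fun g v i u) (ka_fun g v i u') = prefix u u'.
Proof.
move=> gp u u'; elim: u u' i => [|c u IHu] [|c' u'] [|i] //=.
  by case: (eqVneq c c') => //= <-; case: (c == last false v).
by case: (eqVneq c c') => //= <-; case: (c == nth false v i).
Qed.

Definition ka (w v : seq bool) (i : nat) : treeAut :=
  let bk := kb w (size w).-1 in
  @TreeAut (ka_fun bk v i) (ka_fun (tinv bk) v i)
    (ka_funK v i (tactK bk)) (ka_funK v i (tinvK bk))
    (ka_fun_prefix v i (@tact_prefix bk)).

Lemma ka0 w v : last false w != last false v ->
  ka w v 0 = if last false w then tpair (ka w v (size v).-1) (kb w (size w).-1)
             else tpair (kb w (size w).-1) (ka w v (size v).-1).
Proof.
move=> yx; apply: treeAut_eq => -[|c u] /=; first by case: ifP.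
by case: (last false w) (last false v) yx c => -[] // _ [].
Qed.

Lemma kaS w v i :
  ka w v i.+1 = if nth false v i then tpair 1 (ka w v i) else tpair (ka w v i) 1.
Proof. by apply: treeAut_eq => -[|c u] /=; case: nth => //; case: c. Qed.

Definition kneading_gens (w v : seq bool) : set treeAut :=
  [set kb w j | j in `I_(size w)] `|` [set ka w v i | i in `I_(size v)].

Definition kneading (w v : seq bool) : subgroup treeAut :=
  generated (kneading_gens w v).

(* Main.v *)
Require Import Defs.
From HB Require Import structures.
From mathcomp Require Import all_boot all_order all_algebra.
From mathcomp Require Import all_classical.

(** List the generators of G as c_0, ..., c_(N-1) with N = k + n, first b_1,
    ..., b_k and then a_1, ..., a_n. Each c_(m+1) has c_m as one section on the
    first level and 1 as the other, except a_1 = c_k, whose sections are b_k and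
    a_n. For an automorphism g, let plev l g be the parity of the number of
    vertices of level l at which g exchanges the two subtrees. This is a
    homomorphism to Z/2, and plev l c_m = (l == m) for l, m < N (plev_kgen). As
    the c_m are involutions, G/G' is (Z/2)^N, and G' is the set of elements of G
    whose N parities vanish (der_plev).

    The two sections of an element of G' have the same parities, and in each
    section the last parity, dual to a_n, equals the one dual to b_k (wrap_der).
    So N-1 parities of one section tell whether both sections lie in G'. These
    characters sec_par of G' are dual to the commutators [c_0, c_(m+1)]
    (sec_par_comm), which gives G'/(G' x G') as soon as G' x G' <= G'
    (der_quotient).

    For a normal subgroup L of G, L x L <= L holds if <<h, 1>> is in L for a set
    of normal generators h of L, because every element of G is a coordinate of
    an element of G that fixes the first level (G_proj). If L = G' and h is a
    commutator of two generators of G, then <<h, 1>> is a commutator of elements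
    of G, unless the two generators are b_k and a_n. If k, n >= 2, or if k >= 3
    and n = 1, a conjugate of b_k under the group generated by b_1, ..., b_(k-1)
    commutes with a_n, and these b_j are central modulo the group of all h with
    <<h, 1>> in G' (left_factor_last, der_prod_sub).

    If k = 2 and n = 1, or if k = 1 and n >= 2, all commutators of generators
    are, modulo L, products of a few central involutions, which are told apart
    by characters of G' that vanish on L; this identifies G'/L (der_mod). If k =
    1 the only character is one of the sec_par. If k = 2 and n = 1 a second one
    is required: it applies the first character to the quotient g_0^-1 g_1 of
    the sections of g, and it vanishes on L because it is invariant under G and
    trivial on the normal generator of L. The group L/(L x L) embeds in G/L x
    G/L by taking sections; there its generators visibly commute and have the
    orders claimed, and the characters show that there are no further relations
    (quot_isog_cyclic4).

    If k = n = 1, then (sigma a_1)^(2i) has the sections (sigma a_1)^i and its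
    inverse. Hence sigma a_1 has infinite order, and an element of G of the form
    <<h, 1>> is trivial (one_one_rigid), which H x H <= H <= G forbids for non-
    trivial H. *)

Set Implicit Arguments.
Unset Strict Implicit.
Unset Printing Implicit Defensive.

Local Open Scope classical_set_scope.
Local Open Scope group_scope.

(** * Subgroups and their cosets *)

Lemma involution_commJl (T : groupType) (x y : T) :
  x * x = 1 -> [~ x, y] ^ x = [~ x, y]^-1.
Proof.
by move=> xx; rewrite invgR /commg /conjg (mulg1_eq xx) !mulgA xx mul1g.
Qed.

Lemma involution_commJr (T : groupType) (x y : T) :
  y * y = 1 -> [~ x, y] ^ y = [~ x, y]^-1.
Proof.
move=> yy; rewrite invgR /commg /conjg (mulg1_eq yy) !mulgA.
by rewrite -[_ * y * y]mulgA yy mulg1.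
Qed.

Section SubgroupTheory.
Context {T : groupType}.
Implicit Types (S : set T) (G H N K : subgroup T).

Lemma sgX G x m : G x -> G (x ^+ m).
Proof.
by move=> Gx; elim: m => [|m IHm]; [exact: sg1 | rewrite expgS; exact: sgM].
Qed.

Lemma sgJ G x y : G x -> G y -> G (x ^ y).
Proof. by move=> Gx Gy; apply: sgM; [exact: sgV | exact: sgM]. Qed.

Lemma sgR G x y : G x -> G y -> G [~ x, y].
Proof. by move=> Gx Gy; apply: sgM; [exact: sgV | exact: sgJ]. Qed.

Lemma sub_generated S : S `<=` generated S.
Proof. by move=> x Sx H SH; exact: SH. Qed.

Lemma generated_min S H : S `<=` H -> generated S `<=` H.
Proof. by move=> SH x; exact. Qed.

Lemma generated_ind S (P : T -> Prop) :
  P 1 -> (forall x y, P x -> P y -> P (x * y)) ->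
  (forall x, P x -> P x^-1) -> (forall x, S x -> P x) ->
  forall x, generated S x -> P x.
Proof.
by move=> P1 PM PV SP x; apply: (@generated_min _ (@Subgroup T P P1 PM PV)).
Qed.

(** The closure conditions need only be checked inside the subgroup, where for
    instance the elements are known to normalise something. *)
Lemma generated_in_ind S (P : T -> Prop) :
  P 1 ->
  (forall x y, generated S x -> generated S y -> P x -> P y -> P (x * y)) ->
  (forall x, generated S x -> P x -> P x^-1) -> (forall x, S x -> P x) ->
  forall x, generated S x -> P x.
Proof.
move=> P1 PM PV SP x /(@generated_ind S (fun y => generated S y /\ P y)) [] //.
- by split=> //; exact: sg1.
- by move=> y z [Gy Py] [Gz Pz]; split; [exact: sgM | exact: PM].
- by move=> y [Gy Py]; split; [exact: sgV | exact: PV].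
- by move=> y Sy; split; [exact: sub_generated | exact: SP].
Qed.

Definition normaliser N : subgroup T :=
  Subgroup (@normaliser1 T N) (@normaliserM T N) (@normaliserV T N).

Lemma subJ_normaliser N x : (forall y, N y -> N (y ^ x)) ->
  (forall y, N y -> N (y ^ x^-1)) -> normaliser_of N x.
Proof. by move=> Nx NVx y; split=> [/NVx|/Nx//]; rewrite conjgK. Qed.

Lemma involution_normaliser S x : x * x = 1 ->
  (forall y, S y -> generated S (y ^ x)) -> normaliser_of (generated S) x.
Proof.
move=> xx Sx; have Vx : x^-1 = x by exact: mulg1_eq.
have Nx y : generated S y -> generated S (y ^ x).
  move: y; apply: generated_ind => [|y z Sy Sz|y Sy|//].
  - by rewrite conj1g; exact: sg1.
  - by rewrite conjMg; exact: sgM.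
  - by rewrite conjVg; exact: sgV.
by apply: subJ_normaliser => y; rewrite ?Vx; exact: Nx.
Qed.

Lemma generated_normaliser S N :
  S `<=` normaliser_of N -> generated S `<=` normaliser_of N.
Proof. exact: (@generated_min S (normaliser N)). Qed.

Lemma sub_normal_closure G S : S `<=` normal_closure G S.
Proof.
move=> x Sx; apply: sub_generated; exists x => //.
by exists 1; [exact: sg1 | rewrite conjg1].
Qed.

Lemma normal_closure_normal G S : G `<=` normaliser_of (normal_closure G S).
Proof.
have NJ g x : G g -> normal_closure G S x -> normal_closure G S (x ^ g).
  move=> Gg; move: x; apply: generated_ind => [|y z Ny Nz|y Ny|].
  - by rewrite conj1g; exact: sg1.
  - by rewrite conjMg; exact: sgM.
  - by rewrite conjVg; exact: sgV.
  move=> _ [s Ss [h Gh <-]]; rewrite -conjgM; apply: sub_generated.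
  by exists s => //; exists (h * g) => //; exact: sgM.
by move=> g Gg; apply: subJ_normaliser => y; apply: NJ => //; exact: sgV.
Qed.

Lemma normal_closure_min G S K :
  S `<=` K -> G `<=` normaliser_of K -> normal_closure G S `<=` K.
Proof.
move=> SK GK; apply: generated_min => _ [s Ss [g Gg <-]].
by apply/(GK g Gg); exact: SK.
Qed.

Lemma der_sub G : der G `<=` G.
Proof. by apply: generated_min => _ [x Gx [y Gy <-]]; exact: sgR. Qed.

Lemma derR G x y : G x -> G y -> der G [~ x, y].
Proof. by move=> Gx Gy; apply: sub_generated; exists x => //; exists y. Qed.

Lemma der_above_normal G N : der G `<=` N -> N `<=` G -> G `<=` normaliser_of N.
Proof.
move=> GN NG; have NJ g x : G g -> N x -> N (x ^ g).
  move=> Gg Nx; rewrite -(mulVKg x (x ^ g)); apply: sgM => //.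
  by apply/GN/derR => //; exact: NG.
by move=> g Gg; apply: subJ_normaliser => y; apply: NJ => //; exact: sgV.
Qed.

Lemma der_normal G : G `<=` normaliser_of (der G).
Proof. by apply: der_above_normal => //; exact: der_sub. Qed.

End SubgroupTheory.

Section CosetTheory.
Context {T : groupType} (N : subgroup T).
Local Notation NN := (normaliser_of N).
Local Notation pi := (coset_proj N).

Lemma cosetM x y : NN x -> NN y -> pi (x * y) = pi x * pi y.
Proof.
move=> nx ny; rewrite (coset_projE nx) (coset_projE ny).
by rewrite (coset_projE (normaliserM nx ny)) -quotME.
Qed.

Lemma coset1 : pi 1 = 1.
Proof. exact: coset_projE. Qed.

Lemma cosetV x : NN x -> pi x^-1 = (pi x)^-1.
Proof.
by move=> nx; rewrite (coset_projE nx) (coset_projE (normaliserV nx)) -quotVE.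
Qed.

Lemma cosetX x m : NN x -> pi (x ^+ m) = pi x ^+ m.
Proof.
move=> nx; elim: m => [|m IHm]; first exact: coset1.
by rewrite !expgS cosetM ?IHm //; exact: (@sgX _ (normaliser N)).
Qed.

Lemma cosetJ x y : NN x -> NN y -> pi (x ^ y) = pi x ^ pi y.
Proof.
move=> nx ny; rewrite !cosetM ?cosetV //; [exact: normaliserV|].
exact: normaliserM.
Qed.

Lemma cosetR x y : NN x -> NN y -> pi [~ x, y] = [~ pi x, pi y].
Proof.
move=> nx ny; have nVx := normaliserV nx; have nVy := normaliserV ny.
by rewrite cosetM ?cosetV ?cosetJ //; do 2!apply: normaliserM => //.
Qed.

Lemma coset_eq1 x : NN x -> pi x = 1 <-> N x.
Proof.
move=> nx; rewrite (coset_projE nx); split=> [[/= e]|Nx].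
  have [s Ns <-] : rcoset_of N 1 x.
    by rewrite -e; exists 1; [exact: sg1 | rewrite mul1g].
  by rewrite mulg1.
apply: quot_inj => /=; apply/seteqP; split=> _ [s Ns <-].
  by exists (s * x); [exact: sgM | rewrite mulg1].
by exists (s * x^-1); [apply: sgM => //; exact: sgV | rewrite mulgVK mulg1].
Qed.

Lemma coset_eq x y : NN x -> NN y -> pi x = pi y <-> N (x * y^-1).
Proof.
move=> nx ny; have nyV := normaliserV ny; split=> [e|].
  by apply/coset_eq1; [exact: normaliserM | rewrite cosetM // cosetV //
    e mulgV].
move/coset_eq1; rewrite cosetM // cosetV // => e.
by apply: divg1_eq; apply: e; exact: normaliserM.
Qed.

End CosetTheory.

(** * Quotients described by generators *)

Section QuotientByGenerators.
Context {T : groupType}.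
Implicit Types (S : set T) (G H N K : subgroup T).

Lemma commute_generated S N z :
  generated S `<=` normaliser_of N ->
  (forall s, S s -> commute (coset_proj N s) z) ->
  forall g, generated S g -> commute (coset_proj N g) z.
Proof.
move=> nS Sz; apply: generated_in_ind => //.
- by rewrite coset1; exact/commute_sym/commute1.
- move=> x y Gx Gy cx cy; rewrite cosetM; try exact: nS.
  by apply: commute_sym; apply: commuteM; exact: commute_sym.
- move=> x Gx cx; rewrite cosetV; last exact: nS.
  by apply: commute_sym; apply: commuteV; exact: commute_sym.
Qed.

(** The derived subgroup is the least normal subgroup modulo which the
    generators commute. *)
Lemma der_min S K :
  generated S `<=` normaliser_of K ->
  (forall s t, S s -> S t -> K [~ s, t]) -> der (generated S) `<=` K.
Proof.
move=> nK SK; apply: generated_min => _ [x Gx [y Gy <-]].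
apply/coset_eq1; first by apply: nK; exact: sgR.
rewrite cosetR; try exact: nK.
apply/eqP/commgP; move: x Gx; apply: commute_generated => // s Ss.
apply: commute_sym; move: y Gy; apply: commute_generated => // t St.
have [nt ns] : normaliser_of K t /\ normaliser_of K s.
  by split; apply: nK; exact: sub_generated.
apply/commgP; rewrite -cosetR //; apply/eqP/coset_eq1; last exact: SK.
exact: (@sgR _ (normaliser K)).
Qed.

Lemma quot_groupP G N : G `<=` normaliser_of N ->
  quot_group N G = [set coset_proj N x | x in G] :> set _.
Proof.
move=> nG; apply/seteqP; split=> z [x].
  by move=> [Gx _] <-; exists x.
by move=> Gx <-; exists x => //; split=> //; exact: nG.
Qed.

Lemma quot_gen_by_sub G N S :
  normal_in N G -> S `<=` G -> G `<=` generated (S `|` N) -> quot_gen_by G N S.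
Proof.
move=> [NG nG] SG GS; split=> //; apply/seteqP; split.
  rewrite quot_groupP // => _ [x Gx <-].
  suff [] : G x /\ generated [set coset_proj N s | s in S] (coset_proj N x) by
    [].
  move: x {Gx}(GS x Gx); apply: generated_ind.
  - by split; [exact: sg1 | rewrite coset1; exact: sg1].
  - move=> x y [Gx Hx] [Gy Hy]; split; first exact: sgM.
    by rewrite cosetM; [exact: sgM | exact: nG | exact: nG].
  - move=> x [Gx Hx]; split; first exact: sgV.
    by rewrite cosetV; [exact: sgV | exact: nG].
  move=> x [Sx|Nx].
    by split; [exact: SG | apply: sub_generated; exists x].
  split; first exact: NG.
  suff -> : coset_proj N x = 1 by exact: sg1.
  by apply/coset_eq1 => //; exact/nG/NG.
apply: generated_min => _ [s Ss <-]; rewrite quot_groupP //.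
by exists s => //; exact: SG.
Qed.

(** For isomorphisms that are easier to define on the model Q than on G. *)
Lemma isomorphic_into G (Q : groupType) (h : Q -> T) :
  {morph h : x y / x * y >-> x * y} -> (forall x, h x = 1 -> x = 1) ->
  G = range h :> set T -> isomorphic G Q.
Proof.
move=> hM h_inj Gh; have h1 : h 1 = 1 by apply: (mulgI (h 1));
  rewrite -hM !mulg1.
have hV x : h x^-1 = (h x)^-1 by apply/esym/mulg1_eq; rewrite -hM mulgV.
have hI : injective h.
  move=> x y e; apply: divg1_eq; apply: h_inj.
  by rewrite hM hV e mulgV.
pose f x := xget 1 [set q | h q = x].
have fK q : f (h q) = q.
  apply: hI; rewrite /f; case: xgetP => [y _ //|/(_ q)]; by case.
have hK x : G x -> h (f x) = x by rewrite Gh => -[q _ <-]; rewrite fK.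
exists f; split=> [x y|].
  by rewrite Gh => -[p _ <-] [q _ <-]; rewrite -hM !fK.
split=> // [x y|q _].
  by rewrite !inE => Gx Gy e; rewrite -(hK x) // e hK.
by exists (h q); [rewrite Gh; exists q | rewrite fK].
Qed.

Lemma isomorphic_trans G (Q R : groupType) (h : Q -> R) :
  {morph h : x y / x * y >-> x * y} -> bijective h ->
  isomorphic G Q -> isomorphic G R.
Proof.
move=> hM [h' hK h'K] [f [fM [_ fI fS]]]; exists (h \o f); split=> [x y Gx Gy|].
  by rewrite /= fM // hM.
split=> // [x y Gx Gy /= /(can_inj hK)|r _]; first exact: fI.
by have [x Gx e] := fS (h' r) I; exists x => //=; rewrite e h'K.
Qed.

(** The first isomorphism theorem, for a map that is multiplicative on G only. *)
Lemma quot_isog_ker G N (Q : groupType) (f : T -> Q) :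
  (forall x y, G x -> G y -> f (x * y) = f x * f y) ->
  (forall q, exists2 x, G x & f x = q) ->
  (forall x, N x <-> G x /\ f x = 1) -> normal_in N G -> quot_isog G N Q.
Proof.
move=> fM fS kerf nNG; split=> //; have [NG nG] := nNG.
have f1 : f 1 = 1 by apply: (mulgI (f 1)); rewrite -fM ?mulg1 //; exact: sg1.
have fV x : G x -> f x^-1 = (f x)^-1.
  by move=> Gx; apply/esym/mulg1_eq; rewrite -fM ?mulgV //; exact: sgV.
pose rep A := xget 1 (G `&` [set x | coset_proj N x = A]).
have repP x : G x -> G (rep (coset_proj N x)) /\ f (rep (coset_proj N x)) = f x.
  move=> Gx; rewrite /rep; case: xgetP => [y _ [Gy /= e]|/(_ x)[]//].
  split=> //; have /kerf[_] : N (y * x^-1) by apply/coset_eq => //; exact: nG.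
  by rewrite fM ?fV; [exact: divg1_eq|..] => //; exact: sgV.
exists (f \o rep); rewrite quot_groupP //; split.
  move=> _ _ [x Gx <-] [y Gy <-] /=; rewrite -cosetM; try exact: nG.
  by rewrite !(fun x Gx => (repP x Gx).2) ?fM //; exact: sgM.
split=> // [|q _].
  move=> A B; rewrite !inE => -[x Gx <-] [y Gy <-] /=.
  rewrite !(fun x Gx => (repP x Gx).2) // => e; apply/coset_eq; try exact: nG.
  have GVy := sgV Gy; apply/kerf; split; first exact: sgM.
  by rewrite fM // fV // e mulgV.
have [x Gx <-] := fS q; exists (coset_proj N x); first by exists x.
exact: (repP x Gx).2.
Qed.

Lemma finite_indexP H G (R : set T) : finite_set R ->
  (forall x, G x -> exists2 r, R r & H (x * r^-1)) -> finite_index H G.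
Proof.
move=> finR GR; apply: (sub_finite_set _ (finite_image (rcoset_of H) finR)).
move=> _ [x Gx <-]; have [r Rr Hxr] := GR x Gx; exists r => //.
apply/seteqP; split=> _ [s Hs <-].
  exists (s * (x * r^-1)^-1); first by apply: sgM => //; exact: sgV.
  by rewrite invgM invgK !mulgA mulgVK.
exists (s * (x * r^-1)); first exact: sgM.
by rewrite !mulgA mulgVK.
Qed.

End QuotientByGenerators.

(** * Three involutions *)

(** Three involutions D, B, A such that D commutes with C = BA and with its
    own conjugate V by B. As B inverts C, the elements D, V and C generate an
    abelian group of index at most 2, in which the computations below take
    place. *)
Section ThreeInvolutions.
Variables (T : groupType) (D B A C V : T).
Hypotheses (DD : D * D = 1) (BB : B * B = 1) (AA : A * A = 1).
Hypotheses (CE : C = B * A) (VE : V = D ^ B).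
Hypotheses (comDC : commute D C) (comDV : commute D V).

Let DV : D^-1 = D. Proof. exact: mulg1_eq. Qed.
Let BV : B^-1 = B. Proof. exact: mulg1_eq. Qed.
Let AV : A^-1 = A. Proof. exact: mulg1_eq. Qed.
Let AE : A = B * C. Proof. by rewrite CE mulgA BB mul1g. Qed.
Let CV : C^-1 = A * B. Proof. by rewrite CE invgM AV BV. Qed.
Let VBDB : V = B * D * B. Proof. by rewrite VE /conjg BV mulgA. Qed.
Let CJ : B * C * B = C^-1. Proof. by rewrite -AE. Qed.
Let VV : V * V = 1. Proof. by rewrite VE -conjMg DD conj1g. Qed.
Let BV_ : B * V = D * B. Proof. by rewrite VBDB !mulgA BB mul1g. Qed.
Let VB_ : V * B = B * D. Proof. by rewrite VBDB -mulgA BB mulg1. Qed.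
Let BC_ : B * C = C^-1 * B. Proof. by rewrite -CJ -mulgA BB mulg1. Qed.
Let BCV : B * C^-1 = C * B. Proof. by rewrite CV CE !mulgA. Qed.
Let cDCV : commute D C^-1. Proof. exact: commuteV. Qed.

Let comVC : commute V C.
Proof.
by rewrite /commute VBDB -!mulgA BC_ [D * (C^-1 * B)]mulgA cDCV !mulgA BCV.
Qed.

Let cVCV : commute V C^-1. Proof. exact: commuteV. Qed.

Lemma three_commDB : [~ D, B] = D * V.
Proof. by rewrite commgEl DV VE. Qed.

Lemma three_ADB : A * (D * B) = C^-1 * V.
Proof. by rewrite CV VBDB !mulgA -[A * B * B]mulgA BB mulg1. Qed.

Lemma three_BDA : B * (D * A) = V * C.
Proof. by rewrite VBDB CE !mulgA -[_ * B * B]mulgA BB mulg1. Qed.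

Lemma three_BAD : B * (A * D) = C * D.
Proof. by rewrite CE mulgA. Qed.

Lemma three_ABD : A * (B * D) = C^-1 * D.
Proof. by rewrite CV mulgA. Qed.

Lemma three_commDA : [~ D, A] = [~ D, B].
Proof.
rewrite three_commDB commgEl DV /conjg AV; congr (D * _).
have -> : A * (D * A) = C^-1 * (B * (D * A)).
  by rewrite CV !mulgA -[A * B * B]mulgA BB mulg1.
by rewrite three_BDA comVC mulKg.
Qed.

Lemma three_commBA : [~ B, A] = C * C.
Proof. by rewrite /commg /conjg BV AV CE !mulgA. Qed.

Lemma three_commDB_sq : [~ D, B] * [~ D, B] = 1.
Proof.
by rewrite three_commDB mulgA -[D * V * D]mulgA -comDV !mulgA DD mul1g VV.
Qed.

Lemma three_commDB_D : commute D [~ D, B].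
Proof. by rewrite three_commDB; exact: commuteM. Qed.

Lemma three_commDB_C : commute C [~ D, B].
Proof. by rewrite three_commDB; apply: commuteM; exact: commute_sym. Qed.

Lemma three_commDB_B : commute B [~ D, B].
Proof.
by rewrite three_commDB /commute [in LHS]comDV mulgA BV_ -!mulgA -VB_.
Qed.

Lemma three_commDB_A : commute A [~ D, B].
Proof.
rewrite {1}AE; apply: commute_sym; apply: commuteM; apply: commute_sym.
  exact: three_commDB_B.
exact: three_commDB_C.
Qed.

Hypothesis C4 : C ^+ 4 = 1.

Let CC : C * C = C^-1 * C^-1.
Proof.
apply: (mulIg (C * C)).
have -> : C * C * (C * C) = C ^+ 4 by rewrite !expgS expg0 mulg1 !mulgA.
by rewrite C4 !mulgA mulgVK mulVg.
Qed.

Lemma three_commBA_sq : [~ B, A] * [~ B, A] = 1.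
Proof. by rewrite three_commBA -C4 !expgS expg0 mulg1 !mulgA. Qed.

Lemma three_commBA_D : commute D [~ B, A].
Proof. by rewrite three_commBA; exact: commuteM. Qed.

Lemma three_commBA_B : commute B [~ B, A].
Proof.
by rewrite three_commBA /commute [in LHS]CC mulgA BCV -mulgA BCV mulgA.
Qed.

Lemma three_commBA_A : commute A [~ B, A].
Proof.
rewrite {1}AE; apply: commute_sym; apply: commuteM; apply: commute_sym.
  exact: three_commBA_B.
by rewrite three_commBA; exact: commuteM.
Qed.

Lemma three_ADB_sq : A * (D * B) * (A * (D * B)) = [~ B, A].
Proof.
rewrite three_ADB three_commBA CC -mulgA [V * _]mulgA cVCV.
by rewrite !mulgA -[_ * V * V]mulgA VV mulg1.
Qed.

Lemma three_BDA_sq : B * (D * A) * (B * (D * A)) = [~ B, A].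
Proof.
rewrite three_BDA three_commBA -mulgA [C * (V * C)]mulgA -comVC.
by rewrite !mulgA VV mul1g.
Qed.

Lemma three_BAD_sq : B * (A * D) * (B * (A * D)) = [~ B, A].
Proof.
rewrite three_BAD three_commBA -mulgA [D * _]mulgA comDC.
by rewrite !mulgA -[_ * D * D]mulgA DD mulg1.
Qed.

Lemma three_ABD_sq : A * (B * D) * (A * (B * D)) = [~ B, A].
Proof.
rewrite three_ABD three_commBA CC -mulgA [D * _]mulgA cDCV.
by rewrite !mulgA -[_ * D * D]mulgA DD mulg1.
Qed.

Lemma three_ADB_BAD : A * (D * B) * (B * (A * D)) = [~ D, B].
Proof.
rewrite three_ADB three_BAD three_commDB -mulgA [V * _]mulgA comVC !mulgA.
by rewrite mulVg mul1g comDV.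
Qed.

Lemma three_BDA_ABD : B * (D * A) * (A * (B * D)) = [~ D, B].
Proof.
by rewrite three_BDA three_ABD three_commDB -mulgA mulVKg comDV.
Qed.

Lemma three_ADB_D : commute (A * (D * B)) D.
Proof. by apply: commute_sym; rewrite three_ADB; exact: commuteM. Qed.

Lemma three_BDA_D : commute (B * (D * A)) D.
Proof. by apply: commute_sym; rewrite three_BDA; exact: commuteM. Qed.

Lemma three_BAD_D : commute (B * (A * D)) D.
Proof. by apply: commute_sym; rewrite three_BAD; exact: commuteM. Qed.

Lemma three_ABD_D : commute (A * (B * D)) D.
Proof. by apply: commute_sym; rewrite three_ABD; exact: commuteM. Qed.

Lemma three_ABD_BAD : A * (B * D) * (B * (A * D)) = 1.
Proof.
by rewrite three_ABD three_BAD -mulgA [D * _]mulgA comDC -mulgA DD mulg1 mulVg.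
Qed.

Lemma three_BAD_ABD : B * (A * D) * (A * (B * D)) = 1.
Proof.
by rewrite three_ABD three_BAD -mulgA [D * _]mulgA cDCV -mulgA DD mulg1 mulgV.
Qed.

End ThreeInvolutions.

(** Conjugation by D multiplies B by the central involution [D, B], so [B, A]
    and [B^D, A] are both equal to the square of BA. *)
Lemma three_involutions_C4 (T : groupType) (D B A : T) (e : bool) :
  D * D = 1 -> B * B = 1 -> A * A = 1 -> commute D (B * A) ->
  commute D (D ^ B) -> [~ B ^ D ^+ e, A] * [~ B ^ D ^+ e, A] = 1 ->
  (B * A) ^+ 4 = 1.
Proof.
move=> DD BB AA cDC cDV <-; have BV : B^-1 = B by exact: mulg1_eq.
have AV : A^-1 = A by exact: mulg1_eq.
have DV : D^-1 = D by exact: mulg1_eq.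
suff -> : [~ B ^ D ^+ e, A] = B * A * (B * A).
  by rewrite !expgS expg0 mulg1 !mulgA.
rewrite expgb; case: e; last by rewrite conjg1 /commg /conjg BV AV !mulgA.
have BDV : (B ^ D)^-1 = B ^ D by rewrite -conjVg BV.
have BDA : B ^ D * A = [~ D, B] * (B * A).
  by rewrite /commg /conjg DV BV !mulgA -[_ * B * B]mulgA BB mulg1.
have zC : commute (B * A) [~ D, B] by apply: (three_commDB_C (A := A) (V := D ^
  B)).
have zz : [~ D, B] * [~ D, B] = 1 by apply: (three_commDB_sq (V := D ^ B)).
have -> : [~ B ^ D, A] = B ^ D * A * (B ^ D * A).
  by rewrite /commg {2}/conjg BDV AV -!mulgA.
rewrite BDA; move: [~ D, B] (B * A) zC zz => z C zC zz.
by rewrite -mulgA [C * (z * C)]mulgA zC !mulgA zz mul1g.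
Qed.

(** * Integer powers *)

Section IntegerPowers.
Context {T : groupType}.

Definition zexpg (x : T) (m : int) : T :=
  match m with Posz n => x ^+ n | Negz n => x ^- n.+1 end.

Lemma zexpgN x m : zexpg x (- m)%R = (zexpg x m)^-1.
Proof. by case: m => [[|n]|n] /=; rewrite ?invg1 ?invgK. Qed.

Lemma zexpVg x m : zexpg x^-1 m = (zexpg x m)^-1.
Proof. by case: m => n /=; rewrite expVgn. Qed.

Lemma zexpgJ x y m : zexpg (x ^ y) m = zexpg x m ^ y.
Proof. by case: m => n /=; rewrite ?conjVg conjXg. Qed.

Lemma zexpgSr x m : zexpg x (m + 1)%R = zexpg x m * x.
Proof.
case: m => [n|[|n]]; first by rewrite /= addn1 expgSr.
  by rewrite /= expg1 mulVg.
have -> : (Negz n.+1 + 1)%R = Negz n.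
  by rewrite !NegzE -[in LHS]addn1 PoszD GRing.opprD GRing.addrNK.
by rewrite /= [x ^+ n.+2]expgS invgM mulgVK.
Qed.

Lemma zexpgD x m n : zexpg x (m + n)%R = zexpg x m * zexpg x n.
Proof.
elim: n => [|n IHn|n IHn]; first by rewrite GRing.addr0 mulg1.
- by rewrite -addn1 PoszD GRing.addrA zexpgSr IHn zexpgSr mulgA.
apply: (mulIg x); rewrite -mulgA -!zexpgSr -addn1 PoszD GRing.opprD.
by rewrite -!GRing.addrA GRing.addNr !GRing.addr0.
Qed.

Lemma sg_zexpg (G : subgroup T) x m : G x -> G (zexpg x m).
Proof. by move=> Gx; case: m => n /=; [|apply: sgV]; exact: sgX. Qed.

End IntegerPowers.
(** * Quotients described by characters *)

Section BitProducts.
Context {T : groupType}.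
Implicit Types (v u : nat -> bool) (e : nat -> T) (G H : subgroup T).

(** The product of the e_i over the i with v i. For commuting involutions e_i
    it is a homomorphism in v (bitprodD). *)
Definition bitprod m e v := \prod_(i < m) e i ^+ v i.

Lemma eq_bitprod m e v u :
  (forall i, (i < m)%N -> v i = u i) -> bitprod m e v = bitprod m e u.
Proof. by move=> vu; apply: eq_bigr => i _; rewrite vu. Qed.

Lemma bitprodS m e v : bitprod m.+1 e v = bitprod m e v * e m ^+ v m.
Proof. exact: big_ord_recr. Qed.

Lemma bitprod0 m e : bitprod m e (fun=> false) = 1.
Proof. by rewrite /bitprod big1. Qed.

Lemma bitprod_delta m e j :
  (j < m)%N -> bitprod m e (fun i => i == j) = e j.
Proof.
elim: m => // m IHm; rewrite ltnS leq_eqVlt => /predU1P[->|jm]; last first.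
  by rewrite bitprodS IHm // gtn_eqF // mulg1.
rewrite bitprodS eqxx expg1 (@eq_bitprod _ _ _ (fun=> false)) ?bitprod0 ?mul1g
  //.
by move=> i im; rewrite ltn_eqF.
Qed.

Lemma bitprod_mem (G : subgroup T) m e v :
  (forall i, (i < m)%N -> G (e i)) -> G (bitprod m e v).
Proof.
elim: m => [|m IHm] Ge; first by rewrite /bitprod big_ord0; exact: sg1.
rewrite bitprodS; apply: sgM; last exact/sgX/Ge.
by apply: IHm => i im; apply: Ge; exact: ltnW.
Qed.

Lemma commute_bitprod m e v x :
  (forall i, (i < m)%N -> commute x (e i)) -> commute x (bitprod m e v).
Proof. by move=> cx; apply: commute_prod => i _; exact/commuteX/cx. Qed.

Lemma bitprodD m e v u :
  (forall i j, (i < m)%N -> (j < m)%N -> commute (e i) (e j)) ->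
  (forall i, (i < m)%N -> e i * e i = 1) ->
  bitprod m e (fun i => v i (+) u i) = bitprod m e v * bitprod m e u.
Proof.
elim: m => [|m IHm] ce ee; first by rewrite /bitprod !big_ord0 mulg1.
rewrite !bitprodS IHm; first last.
- by move=> i im; apply: ee; exact: ltnW.
- by move=> i j im jm; apply: ce; exact: ltnW.
have cm : commute (e m ^+ v m) (bitprod m e u).
  apply: commute_sym; apply/commuteX/commute_sym/commute_bitprod => i im.
  by apply: ce; [exact: ltnSn | exact: ltnW].
rewrite -!mulgA; congr (_ * _); rewrite mulgA cm -mulgA; congr (_ * _).
by case: (v m) (u m) => -[] //=; rewrite ?mulg1 ?mul1g // expg1 ee.
Qed.

Definition parity_on (G : subgroup T) (f : T -> bool) :=
  forall x y, G x -> G y -> f (x * y) = f x (+) f y.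

Lemma parity1 G f : parity_on G f -> f 1 = false.
Proof.
move=> fM; have := fM _ _ (sg1 G) (sg1 G).
by rewrite mulg1; case: (f 1).
Qed.

Lemma parityV G f x : parity_on G f -> G x -> f x^-1 = f x.
Proof.
move=> fM Gx; have := fM _ _ Gx (sgV Gx).
by rewrite mulgV (parity1 fM); case: (f x); case: (f _).
Qed.

Lemma parityJ G f x y : parity_on G f -> G x -> G y -> f (x ^ y) = f x.
Proof.
move=> fM Gx Gy; have GVy := sgV Gy.
rewrite !fM ?(parityV (x := y) fM) //; last exact: sgM.
by rewrite [f x (+) _]addbC addKb.
Qed.

Lemma parityR G f x y : parity_on G f -> G x -> G y -> f [~ x, y] = false.
Proof.
move=> fM Gx Gy; have GVx := sgV Gx.
by rewrite fM ?(parityV (x := x) fM) ?(parityJ fM) ?addbb //; exact: sgJ.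
Qed.

Lemma parity_der G f x : parity_on G f -> der G x -> f x = false.
Proof.
move=> fM; move: x; apply: generated_in_ind => [|x y|x|].
- exact: parity1 fM.
- by move=> /der_sub Gx /der_sub Gy fx fy; rewrite fM ?fx ?fy.
- by move=> /der_sub Gx fx; rewrite (parityV (x := _) fM).
by move=> _ [x Gx [y Gy <-]]; exact: (parityR fM).
Qed.

Lemma parity_bitprod G f m e v : parity_on G f ->
  (forall i, (i < m)%N -> G (e i)) ->
  f (bitprod m e v) = \big[addb/false]_(i < m) (v i && f (e i)).
Proof.
move=> fM; elim: m => [|m IHm] Ge.
  by rewrite /bitprod !big_ord0 (parity1 fM).
have Gem := Ge m (ltnSn m).
rewrite bitprodS big_ord_recr /= fM; first last.
- by case: (v m); [rewrite expg1 | exact: sg1].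
- by apply: bitprod_mem => i im; apply: Ge; exact: ltnW.
rewrite IHm; last by move=> i im; apply: Ge; exact: ltnW.
by case: (v m); rewrite ?expg1 // (parity1 fM).
Qed.

Lemma parity_bitprod_delta G f m e v j : parity_on G f ->
  (forall i, (i < m)%N -> G (e i)) ->
  (forall i, (i < m)%N -> f (e i) = (j == i)) ->
  f (bitprod m e v) = (j < m)%N && v j.
Proof.
move=> fM Ge fe; rewrite (parity_bitprod _ fM) //.
case: ltnP => jm; last first.
  rewrite big1 // => i _; rewrite fe // gtn_eqF ?andbF //.
  exact: leq_trans (ltn_ord i) jm.
rewrite (bigD1 (Ordinal jm)) //= fe // eqxx andbT big1 ?addbF // => i ne.
by rewrite fe // eq_sym; move: ne; rewrite -val_eqE /= => /negPf ->;
  rewrite andbF.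
Qed.

End BitProducts.

Section RowVectors.
Local Open Scope ring_scope.
Context {m : nat}.
Implicit Types v u : 'rV['Z_2]_m.

(** Entries beyond the length m read as false, so that rows turn into
    functions of a natural number. *)
Definition bit v i : bool := if insub i is Some j then v 0 j != 0 else false.

Definition bits_row (f : nat -> bool) : 'rV['Z_2]_m := \row_i (f i)%:R.

Lemma bit_ord v (i : 'I_m) : bit v i = (v 0 i != 0).
Proof. by rewrite /bit valK. Qed.

Lemma bit_eq v u : (forall i, (i < m)%N -> bit v i = bit u i) -> v = u.
Proof.
move=> e; apply/rowP => i; have := e i (ltn_ord i); rewrite !bit_ord.
by case: (v 0 i) (u 0 i) => -[|[|//]] p [[|[|//]] q] //= _; exact: val_inj.
Qed.

Lemma bitM v u i : bit (v * u)%g i = bit v i (+) bit u i.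
Proof.
rewrite /bit; case: insubP => // j _ _; rewrite mxE.
by case: (v 0 j) (u 0 j) => -[|[|//]] p [[|[|//]] q].
Qed.

Lemma bits_rowK f i : (i < m)%N -> bit (bits_row f) i = f i.
Proof.
by move=> im; rewrite (bit_ord _ (Ordinal im)) mxE /=; case: (f i).
Qed.

End RowVectors.

Section ParityQuotient.
Context {T : groupType}.

(** A finite family of Z/2-valued characters f_i of G, with a dual family e_i
    in G, presents the quotient of G by their common kernel N completely: it
    is elementary abelian, with the images of the e_i as a basis. *)
Lemma parity_quotient (G N : subgroup T) m (f : nat -> T -> bool)
    (e : nat -> T) :
  (forall i, (i < m)%N -> parity_on G (f i)) ->
  (forall i, (i < m)%N -> G (e i)) ->
  (forall i j, (i < m)%N -> (j < m)%N -> f i (e j) = (i == j)) ->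
  (forall x, N x <-> G x /\ forall i, (i < m)%N -> f i x = false) ->
  [/\ quot_isog G N 'rV['Z_2]_m, quot_gen_by G N [set e i | i in `I_m] &
      finite_index N G].
Proof.
move=> fM Ge fe Nf.
have NG : N `<=` G by move=> x /Nf[].
have nNG : normal_in N G.
  split=> // g Gg; have NJ h x : G h -> N x -> N (x ^ h).
    move=> Gh /Nf[Gx fx]; apply/Nf; split=> [|i im]; first exact: sgJ.
    by rewrite (parityJ (fM i im)) ?fx.
  by apply: subJ_normaliser => y; apply: NJ => //; exact: sgV.
have fp v i : (i < m)%N -> f i (bitprod m e v) = v i.
  move=> im; rewrite (parity_bitprod_delta (j := i) _ (fM i im)) ?im //.
  by move=> j jm; exact: fe.
have Nquo x : G x -> N (x * (bitprod m e (f^~ x))^-1).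
  move=> Gx; have Gp := bitprod_mem (f^~ x) Ge.
  apply/Nf; split=> [|i im]; first by apply: sgM => //; exact: sgV.
  by rewrite fM ?(parityV (fM i im)) ?fp ?addbb //; exact: sgV.
split.
- apply: (quot_isog_ker (f := fun x => bits_row (f^~ x))) => //.
  + move=> x y Gx Gy; apply: bit_eq => i im.
    by rewrite bitM !bits_rowK // fM.
  + move=> v; exists (bitprod m e (bit v)); first exact: bitprod_mem.
    by apply: bit_eq => i im; rewrite bits_rowK // fp.
  move=> x; split=> [/Nf[Gx fx]|[Gx fx]].
    split=> //; apply: bit_eq => i im; rewrite bits_rowK // fx //.
    by rewrite -(bits_rowK (fun=> false) im); congr (bit _ _); apply/rowP => j;
      rewrite !mxE.
  apply/Nf; split=> // i im; rewrite -(bits_rowK (f^~ x) im) fx.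
  by rewrite /bit; case: insubP => // j _ _; rewrite mxE eqxx.
- apply: quot_gen_by_sub => // [_ [i im <-]|x Gx]; first exact: Ge.
  rewrite -(mulgVK (bitprod m e (f^~ x)) x); apply: sgM.
    by apply: sub_generated; right; exact: Nquo.
  by apply: bitprod_mem => i im; apply: sub_generated; left; exists i.
apply: (@finite_indexP _ _ _ (range (fun v : 'rV['Z_2]_m =>
  bitprod m e (bit v)))).
  exact/finite_image/finite_finset.
move=> x Gx; exists (bitprod m e (f^~ x)); last exact: Nquo.
exists (bits_row (f^~ x)) => //; apply: eq_bitprod => i im.
by rewrite bits_rowK.
Qed.

Lemma finite_index_trans (L K G : subgroup T) : K `<=` G ->
  finite_index L K -> finite_index K G -> finite_index L G.
Proof.
have reps (A B : subgroup T) : finite_index A B -> exists R : set T,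
    finite_set R /\ forall x, B x -> exists2 r, R r & A (x * r^-1).
  move=> fin; exists [set xget 1 (rcoset_of A x) | x in B]; split.
    apply: sub_finite_set (finite_image (xget 1) fin).
    by move=> _ [x Bx <-]; exists (rcoset_of A x) => //; exists x.
  move=> x Bx; exists (xget 1 (rcoset_of A x)); first by exists x.
  case: xgetP => [_ _ [a Aa <-]|/(_ x)[]]; last first.
    by exists 1; [exact: sg1 | rewrite mul1g].
  by rewrite invgM mulgA mulgV mul1g; exact: sgV.
move=> KG /reps[R [finR RP]] /reps[S [finS SP]].
apply: (@finite_indexP _ _ _ [set r * s | r in R & s in S]).
  exact: finite_image2.
move=> x /SP[s Ss /RP[r Rr Lr]]; exists (r * s); first by exists r => //;
  exists s.
by rewrite invgM mulgA.
Qed.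

End ParityQuotient.

Section CyclicFour.
Context {T : groupType}.

(** The map that sends (i, u) to x^i times the product of the y_j with u_j = 1
    is a homomorphism from the model to the quotient by the power and
    commutation hypotheses, onto because x, the y_j and N generate L, and
    injective by the last hypothesis. *)
Lemma quot_isog_cyclic4 (L N : subgroup T) m (x : T) (y : nat -> T) :
  normal_in N L -> L x -> (forall j, (j < m)%N -> L (y j)) ->
  N (x ^+ 4) -> (forall j, (j < m)%N -> N (y j * y j)) ->
  (forall j, (j < m)%N -> N [~ x, y j]) ->
  (forall i j, (i < m)%N -> (j < m)%N -> N [~ y i, y j]) ->
  L `<=` generated ([set x] `|` [set y j | j in `I_m] `|` N) ->
  (forall i u, (i < 4)%N -> N (x ^+ i * bitprod m y u) ->
     i = 0%N /\ forall j, (j < m)%N -> u j = false) ->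
  quot_isog L N ('Z_4 * 'rV['Z_2]_m)%type.
Proof.
move=> nNL Lx Ly x4 y2 xy yy LS free; split=> //; have [NL nL] := nNL.
pose X := coset_proj N x; pose Y j := coset_proj N (y j).
have cosetL u : N u -> coset_proj N u = 1 by move=> Nu; apply/coset_eq1 => //;
  exact/nL/NL.
have X4 : X ^+ 4 = 1 by rewrite -cosetX ?cosetL //; exact: nL.
have cXY j : (j < m)%N -> commute X (Y j).
  move=> jm; apply/commgP; rewrite -cosetR ?cosetL //;
    by [exact: xy | exact: nL | exact/nL/Ly].
have cYY i j : (i < m)%N -> (j < m)%N -> commute (Y i) (Y j).
  move=> im jm; apply/commgP; rewrite -cosetR ?cosetL //;
    by [exact: yy | exact/nL/Ly].
have Y2 j : (j < m)%N -> Y j * Y j = 1.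
  by move=> jm; rewrite -cosetM ?cosetL //; by [exact: y2 | exact/nL/Ly].
pose h (q : 'Z_4 * 'rV['Z_2]_m) := X ^+ q.1 * bitprod m Y (bit q.2).
have hM : {morph h : p q / (p * q)%g >-> (p * q)%g}.
  move=> [i v] [j u]; rewrite /h /=.
  have -> : bitprod m Y (bit (v * u)%g) = bitprod m Y (bit v) * bitprod m Y
    (bit u).
    by rewrite -bitprodD //; apply: eq_bitprod => l lm; exact: bitM.
  have -> : X ^+ (i * j)%g = X ^+ i * X ^+ j.
    have -> : (i * j)%g = ((i + j) %% 4)%N :> nat by [].
    rewrite -expgnDr {2}(divn_eq (i + j) 4) expgnDr mulnC expgnA X4.
    by rewrite expg1n mul1g.
  have cXv : commute (bitprod m Y (bit v)) (X ^+ j).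
    by apply: commuteX; apply: commute_sym; exact: commute_bitprod.
  by rewrite !mulgA; congr (_ * _); rewrite -!mulgA; congr (_ * _); exact/esym.
have hE i u : (i < 4)%N ->
    coset_proj N (x ^+ i * bitprod m y u) = X ^+ i * bitprod m Y u.
  move=> _; have Lp j : (j <= m)%N -> L (bitprod j y u).
    by move=> jm; apply: bitprod_mem => l lj; apply: Ly; exact: leq_trans jm.
  rewrite cosetM ?cosetX; first congr (_ * _);
    try by apply: nL; by [exact: Lx | exact: Lp | exact: sgX].
  elim: {-2}m (leqnn m) => [|j IHj] jm; first by rewrite /bitprod !big_ord0
    coset1.
  have nyj : normaliser_of N (y j) by exact/nL/Ly.
  rewrite !bitprodS cosetM ?IHj ?cosetX //; first exact: ltnW.
  - by apply/nL/Lp; exact: ltnW.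
  - exact: (@sgX _ (normaliser N)).
apply: (@isomorphic_into _ _ _ h) => //.
  move=> [i v]; rewrite /h /= => e.
  have i4 := ltn_ord i; have [] := @free i (bit v) i4.
    apply/coset_eq1; last by rewrite hE.
    by apply/nL/sgM; [exact: sgX | exact: bitprod_mem].
  move=> i0 v0; congr (_, _); first exact: val_inj.
  apply: bit_eq => j jm; rewrite v0 //.
  by rewrite /bit; case: insubP => // l _ _; rewrite mxE eqxx.
have bit1 j : bit (1%g : 'rV['Z_2]_m) j = false.
  by rewrite /bit; case: insubP => // l _ _; rewrite mxE eqxx.
have h1 : h 1 = 1.
  rewrite /h /= mul1g -(bitprod0 m Y); apply: eq_bitprod => j jm; exact: bit1.
rewrite quot_groupP //; apply/seteqP; split=> [_ [z Lz <-]|_ [[i v] _ <-]].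
  suff [_ [q <-]] : L z /\ exists q, h q = coset_proj N z by exists q.
  move: z {Lz}(LS z Lz); apply: generated_ind.
  - by split; [exact: sg1 | exists 1; rewrite h1 coset1].
  - move=> a b [La [p hp]] [Lb [q hq]]; split; first exact: sgM.
    by exists (p * q)%g; rewrite hM hp hq cosetM //; exact: nL.
  - move=> a [La [p hp]]; split; first exact: sgV.
    exists p^-1%g; rewrite cosetV; last exact: nL.
    by apply/esym/mulg1_eq; rewrite -hp -hM mulgV.
  move=> a [[->|[j jm <-]]|Na].
  - split=> //; exists (inZp 1, 1%g); rewrite /h /= expg1.
    by rewrite (@eq_bitprod _ _ _ _ (fun=> false)) ?bitprod0 ?mulg1.
  - split; first exact: Ly.
    exists (1%g, bits_row (fun i => i == j)); rewrite /h /= mul1g.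
    rewrite (@eq_bitprod _ _ _ _ (fun i => i == j)) ?bitprod_delta //.
    by move=> i im; rewrite bits_rowK.
  by split; [exact: NL | exists 1; rewrite h1 cosetL].
exists (x ^+ i * bitprod m y (bit v)); last by rewrite hE.
by apply: sgM; [exact: sgX | exact: bitprod_mem].
Qed.

End CyclicFour.

(** * Sections and level parities of tree automorphisms *)

Section TreeSections.
Implicit Types (g h : treeAut) (c d : bool) (u : seq bool).

Lemma tree_nil g : g [::] = [::].
Proof.
have : prefix (g [::]) (g (tinv g [::])) by rewrite tact_prefix prefix0s.
by rewrite tinvK; case: (g [::]).
Qed.

(** A word of length m has a chain of m proper prefixes, and g maps it to a
    chain of distinct prefixes. *)
Lemma tree_size_le g u : (size u <= size (g u))%N.
Proof.
elim/last_ind: u => [|u c IHu] //; rewrite size_rcons.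
apply: leq_ltn_trans IHu _; have pu : prefix (g u) (g (rcons u c)).
  by rewrite tact_prefix prefix_rcons.
have [s e] := prefixP pu; rewrite e size_cat -addn1 leq_add2l lt0n size_eq0.
apply/eqP => s0; move: e; rewrite s0 cats0 => /(can_inj (@tactK g)).
by move/(congr1 size); rewrite size_rcons => /eqP; rewrite eqn_leq ltnn.
Qed.

Lemma tree_size g u : size (g u) = size u.
Proof.
apply/eqP; rewrite eqn_leq tree_size_le andbT.
by have := tree_size_le (treeV g) (g u); rewrite /= tactK.
Qed.

Definition act g : bool := head false (g [:: false]).

Lemma tree_cons1 g c : g [:: c] = [:: c (+) act g].
Proof.
have E d : exists d', g [:: d] = [:: d'].
  by have := tree_size g [:: d]; case: (g _) => [|d' []] // _; exists d'.
have [d0 e0] := E false; have [d1 e1] := E true; rewrite /act e0 /=.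
case: c; rewrite // e1; congr [:: _]; case: d0 d1 e0 e1 => -[] // e0 e1;
  by have := can_inj (@tactK g) (etrans e0 (esym e1)).
Qed.

Lemma tree_cons g c u : g (c :: u) = c (+) act g :: behead (g (c :: u)).
Proof.
have : prefix (g [:: c]) (g (c :: u)) by rewrite tact_prefix /= eqxx prefix0s.
rewrite tree_cons1; case: (g (c :: u)) => //= d s.
by rewrite prefix0s andbT => /eqP ->.
Qed.

Lemma act_inv g : act (treeV g) = act g.
Proof.
have := tree_cons1 g (act (treeV g)); rewrite -[X in X _ = _]/(tact g).
have -> : [:: act (treeV g)] = tinv g [:: false].
  by rewrite -[tinv g]/(tact (treeV g)) tree_cons1.
by rewrite tinvK => -[]; case: (act g); case: (act _).
Qed.

(** The automorphism induced by g from the subtree at c to that at its image. *)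
Definition sec g c : treeAut.
Proof.
exists (fun u => behead (g (c :: u)))
       (fun u => behead (tinv g (c (+) act g :: u))).
- by move=> u; rewrite -tree_cons tactK.
- move=> u; have := tree_cons (treeV g) (c (+) act g) u; rewrite act_inv.
  by rewrite -addbA addbb addbF /= => <-; rewrite tinvK.
- move=> u u'; have := tact_prefix g (c :: u) (c :: u').
  by rewrite (tree_cons g c u) (tree_cons g c u') /= !eqxx.
Defined.

Lemma secE g c u : g (c :: u) = c (+) act g :: sec g c u.
Proof. exact: tree_cons. Qed.

Lemma tree_eq g h : act g = act h -> (forall c, sec g c = sec h c) -> g = h.
Proof.
move=> e es; apply: treeAut_eq => -[|c u]; first by rewrite !tree_nil.
by rewrite !secE e es.
Qed.
Lemma actM g h : act (g * h) = act g (+) act h.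
Proof.
have := tree_cons1 (g * h) false; rewrite -[(g * h) _]/(h (g [:: false])).
by rewrite !tree_cons1 => -[].
Qed.
Lemma actV g : act g^-1 = act g. Proof. exact: act_inv. Qed.

Lemma sec1 c : sec 1 c = 1.
Proof. exact: treeAut_eq. Qed.

Lemma secM g h c : sec (g * h) c = sec g c * sec h (c (+) act g).
Proof.
apply: treeAut_eq => u; rewrite -[RHS]/(sec h (c (+) act g) (sec g c u)).
by rewrite /= -[(tact g)]/(tact g) [g (c :: u)]tree_cons.
Qed.

Lemma secV g c : sec g^-1 c = (sec g (c (+) act g))^-1.
Proof.
apply/esym/mulg1_eq; apply: (mulgI (sec g^-1 c)).
have := secM g^-1 g c; rewrite mulVg sec1 actV => e.
by rewrite mulgA -e mulg1 mul1g.
Qed.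
Lemma sec_pair g h c : sec (tpair g h) c = if c then h else g.
Proof. by apply: treeAut_eq => u; case: c. Qed.
Lemma act_sigma : act sigma = true. Proof. by []. Qed.
Lemma sec_sigma c : sec sigma c = 1. Proof. exact: treeAut_eq. Qed.

Lemma tpairE g : act g = false -> g = tpair (sec g false) (sec g true).
Proof. by move=> e; apply: tree_eq => // -[]; rewrite sec_pair. Qed.

Lemma sigma_sq : sigma * sigma = 1.
Proof. by apply: treeAut_eq => -[|[]]. Qed.

Lemma sigmaV : sigma^-1 = sigma.
Proof. exact: mulg1_eq sigma_sq. Qed.

Lemma tpairJsigma g h : tpair g h ^ sigma = tpair h g.
Proof. by apply: treeAut_eq => -[|[]]. Qed.

Lemma sec_conj g h c : act g = false ->
  sec (g ^ h) c = sec g (c (+) act h) ^ sec h (c (+) act h).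
Proof. by move=> ag; rewrite !secM secV actV ag addbF. Qed.

Lemma act_conj g h : act (g ^ h) = act g.
Proof. by rewrite !actM actV addbC -addbA addbb addbF. Qed.

(** The parity of the number of vertices of level l at which g exchanges the
    two subtrees. *)
Fixpoint plev l g : bool :=
  if l is l'.+1 then plev l' (sec g false) (+) plev l' (sec g true) else act g.

Lemma plevM l g h : plev l (g * h) = plev l g (+) plev l h.
Proof.
elim: l g h => [|l IHl] g h; first exact: actM.
rewrite /= !secM !IHl; case: (act g) => /=;
  by case: (plev l _) (plev l _) (plev l _) (plev l _) => -[] [] [].
Qed.

Lemma plev_parity G l : parity_on G (plev l).
Proof. by move=> g h _ _; exact: plevM. Qed.

Lemma plev1 l : plev l 1 = false.
Proof. exact: (parity1 (@plev_parity (generated setT) l)). Qed.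

Lemma plevV l g : plev l g^-1 = plev l g.
Proof.
by apply: (parityV (@plev_parity (generated setT) l)); exact: sub_generated.
Qed.

Lemma plevJ l g h : plev l (g ^ h) = plev l g.
Proof. by rewrite !plevM plevV; case: (plev l h); case: (plev l g). Qed.

Lemma plevS l g : plev l.+1 g = plev l (sec g false) (+) plev l (sec g true).
Proof. by []. Qed.

(** Along the path of a vertex c through the four factors of [g, h], the
    sections of g met are those at both vertices if h is active, and one of
    them twice otherwise; symmetrically for h. *)
Lemma plev_sec_comm l g h c :
  plev l (sec [~ g, h] c) =
  (act h && plev l.+1 g) (+) (act g && plev l.+1 h).
Proof.
rewrite /commg /conjg !secM !secV !plevM !plevV !actV /=.
case: c (act g) (act h) => -[] [] /=;
  move: (plev l (sec g true)) (plev l (sec g false)) (plev l (sec h true))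
    (plev l (sec h false));
  by case=> -[] [] [].
Qed.

End TreeSections.

(** * Automorphisms fixing the first level, and geometric products *)

Definition put (s : bool) (g h : treeAut) := if s then tpair h g else tpair g h.

Lemma act_put s g h : act (put s g h) = false.
Proof. by case: s. Qed.

Lemma sec_put s g h d : sec (put s g h) d = if d == s then g else h.
Proof. by case: s d => -[]; rewrite sec_pair. Qed.

Lemma putM s g h g' h' : put s g h * put s g' h' = put s (g * g') (h * h').
Proof. by case: s; rewrite /put tpairM. Qed.

Lemma putV s g h : (put s g h)^-1 = put s g^-1 h^-1.
Proof. by case: s; rewrite /put tpairV. Qed.

Lemma put11 s : put s 1 1 = 1.
Proof. by case: s; rewrite /put tpair1. Qed.

Lemma putX s g h m : put s g h ^+ m = put s (g ^+ m) (h ^+ m).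
Proof.
by elim: m => [|m IHm]; [rewrite !expg0 put11 | rewrite !expgS IHm putM].
Qed.

Lemma putC s g h : put (~~ s) g h = put s h g.
Proof. by case: s. Qed.

Lemma putJsigma s g h : put s g h ^ sigma = put s h g.
Proof. by case: s; rewrite /put tpairJsigma. Qed.

Lemma putJ s g h g' h' : put s g h ^ put s g' h' = put s (g ^ g') (h ^ h').
Proof. by rewrite /conjg putV !putM. Qed.

Lemma putR s g h g' h' :
  [~ put s g h, put s g' h'] = put s [~ g, g'] [~ h, h'].
Proof. by rewrite /commg putJ putV putM. Qed.

Lemma plev_put l s g h : plev l.+1 (put s g h) = plev l g (+) plev l h.
Proof. by case: s; rewrite plevS !sec_pair // addbC. Qed.

Lemma put_move s t g h : put s g h ^ sigma ^+ (s != t) = put t g h.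
Proof.
by rewrite expgb; case: s t => -[]; rewrite /= ?conjg1 ?tpairJsigma.
Qed.

(** Automorphisms supported on one of the two subtrees can be moved to
    disjoint supports by sigma. *)
Lemma disjoint_support s t g h :
  commute (put s g 1 ^ sigma ^+ (s == t)) (put t h 1).
Proof.
by rewrite expgb; case: s t => -[]; rewrite /= ?conjg1 ?tpairJsigma /commute
  !tpairM !mul1g !mulg1.
Qed.

Lemma commR_sigma s g h :
  [~ sigma, put s g h] = put s (h^-1 * g) (g^-1 * h).
Proof. by rewrite commgEr putV putJsigma putM. Qed.

Lemma geom_prodP (H K : subgroup treeAut) x :
  geom_prod H K x <-> [/\ act x = false, H (sec x false) & K (sec x true)].
Proof.
split=> [[h Hh [k Kk <-]]|[ax Hx Kx]]; first by rewrite !sec_pair.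
by exists (sec x false) => //; exists (sec x true) => //; exact/esym/tpairE.
Qed.

Lemma geom_prod_put (H : subgroup treeAut) s g h :
  geom_prod H H (put s g h) <-> H g /\ H h.
Proof.
rewrite geom_prodP act_put !sec_put; case: s => /=; last by split=> -[].
by split=> [[]|[]].
Qed.

(** L x L lies in K as soon as L lies in the following group, when K is
    normalised by sigma. *)
Definition left_factor (K : subgroup treeAut) : subgroup treeAut.
Proof.
exists [set h | K (tpair h 1)].
- by rewrite /= tpair1; exact: sg1.
- by move=> x y Kx Ky; rewrite /= -[1]mulg1 -tpairM; exact: sgM.
- by move=> x Kx; rewrite /= -[1]invg1 -tpairV; exact: sgV.
Defined.

Lemma geom_prod_sub (L K : subgroup treeAut) :
  normaliser_of K sigma -> L `<=` left_factor K -> geom_prod L L `<=` K.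
Proof.
move=> nK LK _ [g Lg [h Lh <-]].
rewrite -[g]mulg1 -[h]mul1g -tpairM; apply: sgM; first exact: LK.
by rewrite -tpairJsigma; apply/nK; exact: LK.
Qed.

Lemma geom_prod_normal (L : subgroup treeAut) x :
  (forall d, normaliser_of L (sec x d)) -> normaliser_of (geom_prod L L) x.
Proof.
have nL z y : (forall d, normaliser_of L (sec z d)) -> geom_prod L L y ->
    geom_prod L L (y ^ z).
  move=> nz /geom_prodP[ay L0 L1]; apply/geom_prodP; split.
  - by rewrite act_conj.
  - by rewrite sec_conj //; case: (act z); exact/nz.
  - by rewrite sec_conj //; case: (act z); exact/nz.
move=> nx; apply: subJ_normaliser => y; apply: nL => // d.
by rewrite secV; apply: normaliserV; exact: nx.
Qed.

(** The generators b_1, ..., b_k, a_1, ..., a_n in a single list: in this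
    order each of them but the first is built from its predecessor. *)
Definition kgen (w v : seq bool) (m : nat) : treeAut :=
  if (m < size w)%N then kb w m else ka w v (m - size w).

Lemma kneading_gensE w v :
  kneading_gens w v = [set kgen w v m | m in `I_(size w + size v)].
Proof.
apply/seteqP; split=> [_ [[j /= jk <-]|[i /= ni <-]]|_ [m /= mN <-]].
- by exists j; rewrite /kgen /= ?jk // ltn_addr.
- by exists (size w + i)%N; rewrite /kgen /= ?ltn_add2l //
    ltnNge leq_addr addKn.
rewrite /kgen; case: ltnP => [mk|km]; first by left; exists m.
by right; exists (m - size w)%N; rewrite //= ltn_subLR.
Qed.

(** * The group G and its derived subgroup *)

Section Kneading.
Variables w v : seq bool.
Hypothesis w_neq0 : w != [::].
Hypothesis v_neq0 : v != [::].
Hypothesis yk_neq_xn : last false w != last false v.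

Local Notation k := (size w).
Local Notation N := (size w + size v)%N.
Local Notation c := (kgen w v).
Local Notation s := (nth false (w ++ v)).
Local Notation G := (kneading w v).

Let k_gt0 : (0 < k)%N. Proof. by rewrite lt0n size_eq0. Qed.
Let n_gt0 : (0 < size v)%N. Proof. by rewrite lt0n size_eq0. Qed.
Let k_lt_N : (k < N)%N. Proof. by rewrite -addn1 leq_add2l. Qed.
Let NE : N = N.-1.+1. Proof. by rewrite prednK // addn_gt0 k_gt0. Qed.
Let N1_lt : (N.-1 < N)%N. Proof. by rewrite [X in (_ < X)%N]NE. Qed.
Let k1_lt : (k.-1 < N.-1)%N.
Proof. by rewrite -ltnS -NE prednK. Qed.

Lemma kgen0 : c 0%N = sigma.
Proof. by rewrite /kgen k_gt0. Qed.

Lemma kgenS m : (m.+1 < N)%N ->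
  c m.+1 = put (s m) (c m) (if m.+1 == k then c N.-1 else 1).
Proof.
move=> mN; rewrite /kgen nth_cat.
have eN : (N.-1 < k)%N = false.
  by rewrite ltnNge -ltnS -NE k_lt_N.
case: (ltngtP m.+1 k) => [mk|km|mk].
- by rewrite /= /put; case: nth.
- by rewrite ltnS in km; rewrite subSn // kaS /put; case: nth.
rewrite eN mk subnn ka0 //.
have -> : (N.-1 - k = (size v).-1)%N.
  by rewrite -!subn1 subnAC addKn.
by rewrite /put -[m]/(m.+1.-1) mk nth_last; case: (last _ _).
Qed.

(** As a_n is a section of a_1, the induction is on the length of the word
    acted on. *)
Lemma kgen_sq m : (m < N)%N -> c m * c m = 1.
Proof.
move=> mN; apply: treeAut_eq => u; elim: u m mN => [|d u IHu] [|m] mN.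
- by rewrite kgen0 sigma_sq.
- exact: tree_nil.
- by rewrite kgen0 sigma_sq.
rewrite (kgenS mN) putM secE act_put addbF sec_put; congr cons.
case: ifP => _; first by rewrite IHu // ltnW.
by case: ifP => _; rewrite ?IHu // mulg1.
Qed.

Lemma kgenV m : (m < N)%N -> (c m)^-1 = c m.
Proof. by move=> mN; apply: mulg1_eq; exact: kgen_sq. Qed.

(** Passing from c_m to c_(m+1) moves the active vertices one level down. The
    second section a_n of a_1 has none above level N-1, so that it contributes
    to a_1 from level N on only. *)
Lemma plev_kgen l m : (l < N)%N -> (m < N)%N -> plev l (c m) = (l == m).
Proof.
elim: l m => [|l IHl] [|m] lN mN.
- by rewrite kgen0.
- by rewrite (kgenS mN) /= act_put.
- by rewrite kgen0 plevS !sec_sigma !plev1.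
rewrite (kgenS mN) plev_put IHl; try exact: ltnW.
rewrite eqSS; case: (m.+1 == k); last by rewrite plev1 addbF.
rewrite IHl //; last exact: ltnW.
by rewrite [X in _ (+) X](_ : _ = false) ?addbF // ltn_eqF // -ltnS -NE.
Qed.

Lemma kneadingE : G = generated [set c m | m in `I_N].
Proof. by rewrite /kneading kneading_gensE. Qed.

Lemma kgen_in m : (m < N)%N -> G (c m).
Proof. by move=> mN; rewrite kneadingE; apply: sub_generated; exists m. Qed.

Lemma sigma_in : G sigma.
Proof. by rewrite -kgen0; apply: kgen_in; exact: leq_trans k_lt_N. Qed.

Lemma kneading_ind (P : treeAut -> Prop) :
  P 1 -> (forall x y, G x -> G y -> P x -> P y -> P (x * y)) ->
  (forall x, G x -> P x -> P x^-1) -> (forall m, (m < N)%N -> P (c m)) ->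
  forall x, G x -> P x.
Proof.
rewrite kneadingE => P1 PM PV Pc; apply: generated_in_ind => // _ [m mN <-].
exact: Pc.
Qed.

Lemma G_sec g d : G g -> G (sec g d).
Proof.
move=> Gg; move: g Gg d; apply: kneading_ind.
- by move=> d; rewrite sec1; exact: sg1.
- by move=> x y _ _ Gx Gy d; rewrite secM; exact: sgM.
- by move=> x _ Gx d; rewrite secV; exact: sgV.
case=> [|m] mN d; first by rewrite kgen0 sec_sigma; exact: sg1.
rewrite (kgenS mN) sec_put; case: ifP => _; first by apply: kgen_in;
  exact: ltnW.
by case: ifP => _; [apply: kgen_in | exact: sg1].
Qed.

Lemma G_put d g h : G (put d g h) -> G (tpair g h).
Proof.
case: d => //= Ggh; rewrite -tpairJsigma; exact: sgJ sigma_in.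
Qed.

Lemma kgen_pair m : (m.+1 < N)%N -> m.+1 != k -> G (tpair (c m) 1).
Proof.
move=> mN /negPf mk; apply: (@G_put (s m)).
by have := kgen_in mN; rewrite (kgenS mN) mk.
Qed.

Lemma kgen_pair_k : G (tpair (c k.-1) (c N.-1)).
Proof.
have kN : (k.-1.+1 < N)%N by rewrite prednK.
apply: (@G_put (s k.-1)); have := kgen_in kN.
by rewrite (kgenS kN) prednK // eqxx.
Qed.

(** Conjugating by sigma if necessary, c_(m+1) has c_m as its first section
    for m < N-1, and a_1 has a_n. *)
Lemma G_proj g : G g -> exists h, G (tpair g h).
Proof.
move: g; apply: kneading_ind.
- by exists 1; rewrite tpair1; exact: sg1.
- move=> x y _ _ [h Gxh] [h' Gyh']; exists (h * h').
  by rewrite -tpairM; exact: sgM.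
- by move=> x _ [h Gxh]; exists h^-1; rewrite -tpairV; exact: sgV.
move=> m mN; have [mN1|] := ltnP m.+1 N.
  have [mk|mk] := eqVneq m.+1 k; last by exists 1; exact: kgen_pair.
  by exists (c N.-1); rewrite -[m]/(m.+1.-1) mk; exact: kgen_pair_k.
move=> Nm; have -> : m = N.-1.
  by apply/eqP; rewrite eqn_leq -ltnS -NE mN /= -ltnS -NE.
exists (c k.-1); rewrite -tpairJsigma; apply: sgJ kgen_pair_k _;
  exact: sigma_in.
Qed.

Lemma left_factor_normal (K : subgroup treeAut) :
  G `<=` normaliser_of K -> G `<=` normaliser_of (left_factor K).
Proof.
move=> nK g Gg; have KJ h x : G h -> left_factor K x -> left_factor K (x ^ h).
  move=> /G_proj[h' Gh] /= Kx; rewrite -[1](conj1g h').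
  by have := putJ false x 1 h h'; rewrite /put => <-; exact/(nK _ Gh).
by apply: subJ_normaliser => x; apply: KJ => //; exact: sgV.
Qed.

Lemma geom_prod_G_normal (L : subgroup treeAut) :
  G `<=` normaliser_of L -> G `<=` normaliser_of (geom_prod L L).
Proof. by move=> nL g Gg; apply: geom_prod_normal => d; exact/nL/G_sec. Qed.

Lemma der_kneading_min (K : subgroup treeAut) : G `<=` normaliser_of K ->
  (forall i j, (i < j)%N -> (j < N)%N -> K [~ c i, c j]) -> der G `<=` K.
Proof.
rewrite kneadingE => nK Kc; apply: der_min => // _ _ [i iN <-] [j jN <-].
have [ij|ji|->] := ltngtP i j; first exact: Kc.
  by rewrite -invgR; apply: sgV; exact: Kc.
by rewrite commgg; exact: sg1.
Qed.

(** The generators commute modulo G' and square to 1, so that g is congruent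
    to the product of the generators whose parity in g is odd. *)
Lemma der_plev g :
  der G g <-> G g /\ forall l, (l < N)%N -> plev l g = false.
Proof.
split=> [Dg|[Gg g0]].
  split=> [|l _]; first exact: der_sub Dg.
  exact: parity_der (@plev_parity G l) Dg.
have nD := @der_normal _ G; have nc m : (m < N)%N -> normaliser_of (der G) (c
  m).
  by move=> mN; exact/nD/kgen_in.
pose F := bitprod N (fun m => coset_proj (der G) (c m)).
have F0 : F (fun=> false) = 1 by exact: bitprod0.
have F_M f f' : F (fun i => f i (+) f' i) = F f * F f'.
  apply: bitprodD => [i j iN jN|i iN].
    apply/commgP; rewrite -cosetR; try exact: nc.
    by apply/eqP/coset_eq1; [apply/nD/sgR; exact: kgen_in | apply: derR;
      exact: kgen_in].
  by rewrite -cosetM ?kgen_sq ?coset1 //; exact: nc.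
have FE x : G x -> coset_proj (der G) x = F (plev^~ x).
  move: x; apply: kneading_ind.
  - by rewrite coset1 -F0; apply: eq_bitprod => i _; rewrite plev1.
  - move=> x y Gx Gy ex ey; rewrite cosetM; try exact: nD.
    by rewrite ex ey -F_M; apply: eq_bitprod => i _; rewrite plevM.
  - move=> x Gx ex; rewrite cosetV; last exact: nD.
    apply: mulg1_eq; rewrite ex -F_M -F0.
    by apply: eq_bitprod => i _; rewrite plevV addbb.
  move=> m mN; have <- : F (fun i => i == m) = coset_proj (der G) (c m).
    exact: bitprod_delta.
  by apply: eq_bitprod => i iN; rewrite plev_kgen.
apply/coset_eq1; first exact: nD.
by rewrite FE // -F0; apply: eq_bitprod => i iN; exact: g0.
Qed.

Lemma abelianization :
  [/\ quot_isog G (der G) 'rV['Z_2]_N,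
      quot_gen_by G (der G) [set c m | m in `I_N] &
      finite_index (der G) G].
Proof.
apply: (parity_quotient (f := plev)) => [i _|i iN|i j iN jN|g].
- exact: plev_parity.
- exact: kgen_in.
- exact: plev_kgen.
exact: der_plev.
Qed.

Lemma der_act g : der G g -> act g = false.
Proof. exact: parity_der (@plev_parity G 0%N). Qed.

Lemma der_sec l g d : der G g -> plev l (sec g d) = plev l (sec g false).
Proof.
move=> /(parity_der (@plev_parity G l.+1)); rewrite plevS.
by case: d => //; case: (plev l _) (plev l _) => -[].
Qed.

(** This adds the parities dual to b_k and to a_n in the section of g at d. On
    generators it is non-zero for a_1 only, whose sections are precisely b_k
    and a_n: hence it does not depend on d. *)
Definition wrap g d := plev N.-1 (sec g d) (+) plev k.-1 (sec g d).

Lemma wrapM g h d : wrap (g * h) d = wrap g d (+) wrap h (d (+) act g).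
Proof.
rewrite /wrap secM !plevM.
by case: (plev _ _) (plev _ _) (plev _ _) (plev _ _) => -[] [] [].
Qed.

Lemma wrapV g d : wrap g^-1 d = wrap g (d (+) act g).
Proof. by rewrite /wrap secV !plevV. Qed.

Lemma wrap_side g d : G g -> wrap g d = wrap g false.
Proof.
move=> Gg; move: g Gg d; apply: kneading_ind.
- by move=> d; rewrite /wrap !sec1.
- by move=> x y _ _ ex ey d; rewrite !wrapM ex ey [in RHS]ey.
- by move=> x _ ex d; rewrite !wrapV ex [in RHS]ex.
have k1N : (k.-1 < N)%N by exact: ltn_trans N1_lt.
case=> [|m] mN d; first by rewrite kgen0 /wrap !sec_sigma.
have wc i : (i < N)%N ->
    plev N.-1 (c i) (+) plev k.-1 (c i) = (N.-1 == i) (+) (k.-1 == i).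
  by move=> iN; rewrite !plev_kgen.
have mN1 : (m < N.-1)%N by rewrite -ltnS -NE.
have wm : plev N.-1 (c m) (+) plev k.-1 (c m) = (m.+1 == k).
  by rewrite wc ?(ltnW mN) // gtn_eqF //= -eqSS prednK // eq_sym.
have w1 : plev N.-1 (c N.-1) (+) plev k.-1 (c N.-1) = true.
  by rewrite wc // eqxx ltn_eqF.
rewrite /wrap (kgenS mN) !sec_put.
set x := if _ then c N.-1 else 1.
have wx : plev N.-1 x (+) plev k.-1 x = (m.+1 == k).
  by rewrite /x; case: (m.+1 == k); rewrite ?w1 ?plev1.
by case: (d == s m); case: (false == s m); rewrite ?wm ?wx.
Qed.

Lemma wrap_parity : parity_on G (wrap^~ false).
Proof. by move=> x y Gx Gy; rewrite wrapM [wrap y (_ (+) _)]wrap_side. Qed.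

Lemma wrap_der g : der G g -> plev N.-1 (sec g false) = plev k.-1 (sec g false).
Proof.
by move=> /(parity_der wrap_parity); rewrite /wrap;
  case: (plev _ _) (plev _ _) => -[].
Qed.

(** Parities of the first section. They determine an element of G' modulo G'
    x G'; wrap_der makes the last of the N parities redundant. *)
Definition sec_par l g := plev l (sec g false).

Lemma sec_par_parity l : parity_on (der G) (sec_par l).
Proof. by move=> g h Dg _; rewrite /sec_par secM plevM (der_act Dg). Qed.

Lemma sec_parJ l g h : der G g -> sec_par l (g ^ h) = sec_par l g.
Proof.
by move=> Dg; rewrite /sec_par sec_conj ?plevJ ?(der_sec _ _ Dg) ?der_act.
Qed.

Lemma sec_par_comm l m : (l < N.-1)%N -> (m < N.-1)%N ->
  sec_par l [~ c 0%N, c m.+1] = (l == m).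
Proof.
move=> lN mN; have mN1 : (m.+1 < N)%N by rewrite NE ltnS.
rewrite /sec_par plev_sec_comm kgen0 (kgenS mN1) act_put act_sigma /=.
by rewrite -(kgenS mN1) -plevS plev_kgen // NE ltnS.
Qed.

Lemma der_sections g : der G g ->
  (forall l, (l < N.-1)%N -> sec_par l g = false) -> forall d, der G (sec g d).
Proof.
move=> Dg g0 d; apply/der_plev; split=> [|l]; first exact/G_sec/der_sub.
rewrite NE ltnS leq_eqVlt der_sec // => /predU1P[->|lN]; last exact: g0.
by rewrite wrap_der //; exact: g0.
Qed.

Lemma der_quotient : geom_prod (der G) (der G) `<=` der G ->
  [/\ quot_isog (der G) (geom_prod (der G) (der G)) 'rV['Z_2]_N.-1,
      quot_gen_by (der G) (geom_prod (der G) (der G))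
        [set [~ c 0%N, c m.+1] | m in `I_N.-1] &
      finite_index (geom_prod (der G) (der G)) (der G)].
Proof.
move=> DD; apply: (parity_quotient (f := sec_par)) => [l _|m mN|l m lN mN|g].
- exact: sec_par_parity.
- by apply: derR; apply: kgen_in; rewrite NE.
- exact: sec_par_comm.
split=> [DDg|[Dg g0]].
  split=> [|l lN]; first exact: DD.
  have /geom_prodP[_ /der_plev[_ D0] _] := DDg; apply: D0.
  by rewrite NE; exact: ltnW.
have Ds := der_sections Dg g0; apply/geom_prodP; split=> //; exact: der_act.
Qed.

(** For c_i other than b_k and a_n, <<c_i, 1>> is a conjugate of c_(i+1) by a
    power of sigma, hence in G. *)
Lemma left_factor_comm i j : (i < N.-1)%N -> i != k.-1 -> (j < N)%N ->
  left_factor (der G) [~ c i, c j].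
Proof.
move=> iN ik jN; have [h Gh] := G_proj (kgen_in jN).
have Gi : G (tpair (c i) 1).
  by apply: kgen_pair; [rewrite NE | rewrite -(prednK k_gt0)].
by have := derR Gi Gh; rewrite -[tpair (c i) 1]/(put false _ _)
  -[tpair (c j) h]/(put false _ _) putR comm1g.
Qed.

(** The generators b_1, ..., b_(k-1) are central modulo the left factor of
    G', so that the commutator of b_k and a_n may be computed on conjugates. *)
Lemma left_factor_last g :
  generated [set c i | i in `I_k.-1] g -> commute (c k.-1 ^ g) (c N.-1) ->
  left_factor (der G) [~ c k.-1, c N.-1].
Proof.
set M := left_factor _ => Sg cg.
have k1N : (k.-1 < N)%N by exact: ltn_trans N1_lt.
have nM : G `<=` normaliser_of M := left_factor_normal (@der_normal _ G).
have SG : generated [set c i | i in `I_k.-1] `<=` G.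
  by apply: generated_min => _ [i ik <-]; apply: kgen_in; exact: ltn_trans k1N.
have nk := nM _ (kgen_in k1N); have nN := nM _ (kgen_in N1_lt).
have ng := nM _ (SG _ Sg).
have : commute (coset_proj M g) (coset_proj M (c k.-1)).
  move: g Sg {cg ng}; apply: commute_generated.
    by move=> x /SG; exact: nM.
  move=> _ [i ik <-]; have iN : (i < N)%N by exact: ltn_trans k1N.
  have ni := nM _ (kgen_in iN).
  apply/commgP; rewrite -cosetR //; apply/eqP/coset_eq1.
    exact: (@sgR _ (normaliser M)).
  by apply: left_factor_comm => //; [exact: ltn_trans k1_lt | rewrite ltn_eqF].
move=> /commute_sym/commgP/conjg_fixP ck.
apply/coset_eq1; first exact: (@sgR _ (normaliser M)).
have nkg := @sgJ _ (normaliser M) _ _ nk ng.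
rewrite cosetR // -ck -cosetJ // -cosetR //.
by have /commgP/eqP -> := cg; exact: coset1.
Qed.

(** The commutator [b_k, a_n] is the only one that is not covered by
    left_factor_comm. For k, n >= 2, both b_k and a_n have a trivial section,
    and conjugation by a power of sigma makes their supports disjoint. *)
Lemma der_prod_sub :
  ((2 <= k)%N /\ (2 <= size v)%N) \/ ((3 <= k)%N /\ size v = 1%N) ->
  geom_prod (der G) (der G) `<=` der G.
Proof.
move=> hkn; apply: geom_prod_sub; first by apply: der_normal; exact: sigma_in.
have k1N : (k.-1 < N)%N by exact: ltn_trans N1_lt.
apply: der_kneading_min.
  by apply: left_factor_normal; exact: der_normal.
move=> i j ij jN; have iN1 : (i < N.-1)%N.
  by rewrite -ltnS -NE; exact: leq_ltn_trans jN.
have [->{i ij iN1}|ik] := eqVneq i k.-1; last exact: left_factor_comm.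
have [->{j jN}|jN1] := eqVneq j N.-1; last first.
  have [->|jk] := eqVneq j k.-1; first by rewrite commgg; exact: sg1.
  rewrite -invgR; apply: sgV; apply: left_factor_comm => //.
  by rewrite ltn_neqAle jN1 -ltnS -NE.
have inS i : (i < k.-1)%N -> generated [set c i | i in `I_k.-1] (c i).
  by move=> ik; apply: sub_generated; exists i.
have k2 : (1 < k)%N by case: hkn => -[// /ltnW].
have k1S : k.-1 = k.-2.+1 by rewrite prednK // -ltnS prednK.
have ck : c k.-1 = put (s k.-2) (c k.-2) 1.
  by rewrite k1S kgenS -?k1S // ltn_eqF ?prednK.
have sS : generated [set c i | i in `I_k.-1] sigma.
  by rewrite -kgen0; apply: inS; rewrite k1S.
case: hkn => [[_ n2]|[k3 n1]].
  have N1S : N.-1 = N.-2.+1 by rewrite prednK //; exact: leq_ltn_trans k1_lt.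
  have cN : c N.-1 = put (s N.-2) (c N.-2) 1.
    rewrite N1S kgenS -?N1S // gtn_eqF // -ltnS -NE.
    by rewrite -addn2 leq_add2l.
  apply: (left_factor_last (g := sigma ^+ (s k.-2 == s N.-2))).
    exact: sgX.
  by rewrite ck cN; exact: disjoint_support.
(* With n = 1, a_n = a_1 has b_k as a section, which commutes with the
   conjugate of b_(k-1) by a suitable power of sigma: move b_k to the side of
   this section and conjugate it there. *)
have NK : N.-1 = k by rewrite n1 addn1.
have k2S : k.-2 = (k - 3).+1%N by rewrite -subn2 subnSK.
have ck2 : c k.-2 = put (s (k - 3)%N) (c (k - 3)%N) 1.
  have k2k : (k.-2 == k) = false by rewrite ltn_eqF // -k1S leq_pred.
  by rewrite k2S kgenS -k2S ?k2k //; exact: leq_ltn_trans (leq_pred _) k1N.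
have cN : c N.-1 = put (s k.-1) (c k.-1) (c N.-1).
  have kN : (k.-1.+1 < N)%N by rewrite prednK.
  by rewrite {1}NK -{1}(prednK k_gt0) (kgenS kN) prednK // eqxx.
pose e := s (k - 3)%N == s k.-2.
have c1 : c 1%N = put (s 0%N) sigma 1.
  by rewrite kgenS ?kgen0 ?ltn_eqF //; exact: ltn_trans k_lt_N.
apply: (left_factor_last
  (g := sigma ^+ (s k.-2 != s k.-1) * put (s k.-1) (sigma ^+ e) 1)).
  apply: sgM; first exact: sgX.
  have -> : put (s k.-1) (sigma ^+ e) 1 = (c 1%N ^ sigma ^+ (s 0%N != s k.-1))
    ^+ e.
    by rewrite c1 put_move putX expg1n.
  apply: sgX; apply: sgJ; last exact: sgX.
  by apply: inS; rewrite k1S k2S.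
rewrite conjgM {1}ck put_move putJ conj1g cN /commute !putM mulg1 mul1g.
have := disjoint_support (s (k - 3)%N) (s k.-2) (c (k - 3)%N) (c k.-2).
by rewrite -ck2 -ck -/e /commute => ->.
Qed.

Lemma der_case :
  ((2 <= k)%N /\ (2 <= size v)%N) \/ ((3 <= k)%N /\ size v = 1%N) ->
  [/\ branch_on G (der G),
      quot_isog G (der G) 'rV['Z_2]_N /\
      quot_gen_by G (der G) [set c m | m in `I_N] &
      quot_isog (der G) (geom_prod (der G) (der G)) 'rV['Z_2]_N.-1 /\
      quot_gen_by (der G) (geom_prod (der G) (der G))
        [set [~ c 0%N, c m.+1] | m in `I_N.-1]].
Proof.
move=> hkn; have DD := der_prod_sub hkn.
have [iso gen fin] := abelianization; have [iso' gen' _] := der_quotient DD.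
split=> //; split=> //; split=> //; first exact: der_sub.
have N1_gt0 : (0 < N.-1)%N by exact: leq_ltn_trans k1_lt.
exists [~ c 0%N, c 1%N].
  by apply: derR; apply: kgen_in; rewrite NE.
by move=> e; have := sec_par_comm N1_gt0 N1_gt0; rewrite e /sec_par sec1 plev1.
Qed.

Definition central_mod (L : subgroup treeAut) u :=
  G u /\ forall g, G g -> L [~ u, g].

Lemma central_modE (L : subgroup treeAut) u : G `<=` normaliser_of L -> G u ->
  (forall j, (j < N)%N -> commute (coset_proj L (c j)) (coset_proj L u)) ->
  central_mod L u.
Proof.
move=> nL Gu cu; split=> // g Gg.
apply/coset_eq1; first by apply: nL; exact: sgR.
rewrite cosetR; try exact: nL.
apply/eqP/commgP/commute_sym; rewrite kneadingE in nL Gg.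
move: g Gg; apply: commute_generated => // _ [j jN <-]; exact: cu.
Qed.

Lemma central_mod_gens (L : subgroup treeAut) u :
  G `<=` normaliser_of L -> G u ->
  (forall j, (j < N)%N -> L [~ u, c j]) -> central_mod L u.
Proof.
move=> nL Gu cu; apply: central_modE => // j jN; apply/commute_sym/commgP.
have Gc := kgen_in jN; rewrite -cosetR; try exact: nL.
by apply/eqP/coset_eq1; [apply/nL/sgR | exact: cu].
Qed.

Lemma central_mod_commute (L : subgroup treeAut) u g : G `<=` normaliser_of L ->
  central_mod L u -> G g -> commute (coset_proj L u) (coset_proj L g).
Proof.
move=> nL [Gu Lu] Gg; apply/commgP; rewrite -cosetR; try exact: nL.
by apply/eqP/coset_eq1; [apply/nL/sgR | exact: Lu].
Qed.

Lemma central_mod_sym (L : subgroup treeAut) u g :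
  central_mod L u -> G g -> L [~ g, u].
Proof. by move=> [_ Lu] Gg; rewrite -invgR; apply: sgV; exact: Lu. Qed.

Lemma central_modJ (L : subgroup treeAut) u h : G `<=` normaliser_of L ->
  central_mod L u -> G h -> central_mod L (u ^ h).
Proof.
move=> nL [Gu Lu] Gh; split=> [|g Gg]; first exact: sgJ.
rewrite -[g](conjgKV h) -conjRg; apply/(nL _ Gh)/Lu; apply: sgJ => //.
exact: sgV.
Qed.

Lemma central_mod1 (L : subgroup treeAut) : central_mod L 1.
Proof. by split=> [|g _]; [exact: sg1 | rewrite comm1g; exact: sg1]. Qed.

(** Commutators of elements fixing the first level are taken sectionwise. *)
Lemma geom_prod_comm (L : subgroup treeAut) x y : act x = false ->
  act y = false -> (forall d, L [~ sec x d, sec y d]) ->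
  geom_prod L L [~ x, y].
Proof.
move=> ax ay Lxy; rewrite [x in [~ x, _]](tpairE ax) [X in [~ _, X]](tpairE ay).
have := putR false (sec x false) (sec x true) (sec y false) (sec y true).
rewrite /put => ->; exists [~ sec x false, sec y false]; first exact: Lxy.
by exists [~ sec x true, sec y true]; first exact: Lxy.
Qed.

Lemma geom_prod_comm_central (L : subgroup treeAut) x y : G x ->
  act x = false -> act y = false -> (forall d, central_mod L (sec y d)) ->
  geom_prod L L [~ x, y].
Proof.
move=> Gx ax ay cy; apply: geom_prod_comm => // d.
by apply: central_mod_sym => //; exact: G_sec.
Qed.

(** Modulo L, the products of the e_i form a central subgroup, which contains
    all commutators of generators. So each element of G' is congruent to such
    a product, and the characters f_i read off its exponents. *)
Lemma der_mod (L : subgroup treeAut) m (f : nat -> treeAut -> bool)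
    (e : nat -> treeAut) :
  L `<=` der G -> G `<=` normaliser_of L ->
  (forall i, (i < m)%N -> parity_on (der G) (f i)) ->
  (forall i, (i < m)%N -> forall x, L x -> f i x = false) ->
  (forall i, (i < m)%N -> der G (e i)) ->
  (forall i j, (i < m)%N -> (j < m)%N -> f i (e j) = (i == j)) ->
  (forall i, (i < m)%N -> L (e i * e i)) ->
  (forall i, (i < m)%N -> central_mod L (e i)) ->
  (forall i j, (i < j)%N -> (j < N)%N -> exists u,
     coset_proj L [~ c i, c j] = bitprod m (fun l => coset_proj L (e l)) u) ->
  [/\ quot_isog (der G) L 'rV['Z_2]_m,
      quot_gen_by (der G) L [set e i | i in `I_m] & finite_index L G].
Proof.
move=> LD nL fM fL De fe ee ce ec; set E := bitprod m _ in ec.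
have Ge i : (i < m)%N -> G (e i) by move=> im; exact: der_sub (De i im).
have E0 : E (fun=> false) = 1 by exact: bitprod0.
have E_M u u' : E (fun i => u i (+) u' i) = E u * E u'.
  apply: bitprodD => [i j im jm|i im].
    by apply: central_mod_commute => //; [exact: ce | exact: Ge].
  have := ee i im; have nei := nL _ (Ge i im); rewrite -cosetM //.
  by move/coset_eq1; apply; exact: normaliserM.
pose K0 := [set x | G x /\ exists u, coset_proj L x = E u].
have K1 : K0 1.
  by split; [exact: sg1 | exists (fun=> false); rewrite E0 coset1].
have KM x y : K0 x -> K0 y -> K0 (x * y).
  move=> [Gx [u ex]] [Gy [u' ey]]; split; first exact: sgM.
  by exists (fun i => u i (+) u' i); rewrite E_M -ex -ey cosetM; try exact: nL.
have KV x : K0 x -> K0 x^-1.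
  move=> [Gx [u ex]]; split; first exact: sgV.
  exists u; rewrite cosetV; last exact: nL.
  apply: mulg1_eq; rewrite ex -E_M -E0.
  by apply: eq_bitprod => i _; rewrite addbb.
pose K := Subgroup K1 KM KV.
have nK : G `<=` normaliser_of K.
  have KJ g x : G g -> K x -> K (x ^ g).
    move=> Gg [Gx [u ex]]; split; first exact: sgJ.
    exists u; rewrite cosetJ; try exact: nL.
    rewrite ex; apply/conjg_fixP/commgP/commute_sym;
      apply: commute_bitprod => i im.
    by apply/commute_sym/central_mod_commute => //; exact: ce.
  by move=> g Gg; apply: subJ_normaliser => x; apply: KJ => //; exact: sgV.
have DK : der G `<=` K.
  apply: der_kneading_min => // i j ij jN; split; last exact: ec.
  by apply: sgR; apply: kgen_in => //; exact: ltn_trans jN.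
have EE u : coset_proj L (bitprod m e u) = E u.
  rewrite /E; elim: {-2}m (leqnn m) => [|j IHj] jm.
    by rewrite /bitprod !big_ord0 coset1.
  have nej : normaliser_of L (e j) by exact/nL/Ge.
  rewrite !bitprodS cosetM ?IHj ?cosetX //; first exact: ltnW.
  - apply/nL/bitprod_mem => i ij; apply: Ge; exact: ltn_trans jm.
  - exact: (@sgX _ (normaliser L)).
have [] := parity_quotient (G := der G) (N := L) fM De fe.
  move=> x; split=> [Lx|[Dx fx]].
    by split=> [|i im]; [exact: LD | exact: fL].
  have [Gx [u ex]] := DK x Dx; have nx := nL _ Gx.
  have Dp : der G (bitprod m e u) by exact: bitprod_mem.
  have nLp : L (x * (bitprod m e u)^-1).
    by apply/coset_eq; rewrite ?ex ?EE //; exact/nL/der_sub.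
  have u0 i : (i < m)%N -> u i = false.
    move=> im; have := fL i im _ nLp.
    rewrite (fM i im) ?fx // ?(parityV (fM i im)) //; last exact: sgV.
    by rewrite (parity_bitprod_delta (j := i) _ (fM i im)) ?im // => j;
      exact: fe.
  by apply/coset_eq1 => //; rewrite ex -E0; exact: eq_bitprod.
move=> isog gen fin; split=> //; apply: finite_index_trans fin _.
  exact: der_sub.
by have [] := abelianization.
Qed.

Lemma normal_closure_sec_par l S : S `<=` der G ->
  (forall x, S x -> sec_par l x = false) ->
  forall x, normal_closure G S x -> sec_par l x = false.
Proof.
move=> SD S0; have nD := @normal_closure_min _ G S _ SD (@der_normal _ G).
apply: generated_in_ind.
- by rewrite /sec_par sec1 plev1.
- by move=> x y /nD Dx /nD Dy ex ey; rewrite sec_par_parity ?ex ?ey.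
- by move=> x /nD Dx ex; rewrite (parityV (@sec_par_parity l)).
by move=> _ [x Sx [g Gg <-]]; rewrite sec_parJ ?S0 //; exact: SD.
Qed.

(** * The case k = 1 and n >= 2 *)

Section CaseOneMany.
Hypothesis k1 : k = 1%N.
Hypothesis n_gt1 : (1 < size v)%N.

Local Notation n := (size v).

Definition branch1n : subgroup treeAut := normal_closure G
  ([set g | exists i j, (i < j < n)%N /\ g = [~ c i.+1, c j.+1]] `|`
   [set [~ c i.+1, c 0%N] | i in [set i | (i < n.-1)%N]]).
Local Notation L := branch1n.
Local Notation M := (geom_prod L L).

Let Nn : N = n.+1. Proof. by rewrite k1. Qed.
Let N1n : N.-1 = n. Proof. by rewrite Nn. Qed.
Let nS : n.-1.+1 = n. Proof. by rewrite prednK // ltnW. Qed.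

Let c1 : c 1%N = put (s 0%N) sigma (c n).
Proof. by rewrite kgenS ?k1 ?Nn //= kgen0. Qed.

Let cS m : (0 < m)%N -> (m < n)%N -> c m.+1 = put (s m) (c m) 1.
Proof. by move=> m0 mn; rewrite kgenS ?Nn ?k1 ?gtn_eqF. Qed.

Lemma branch1n_gens_der :
  ([set g | exists i j, (i < j < n)%N /\ g = [~ c i.+1, c j.+1]] `|`
   [set [~ c i.+1, c 0%N] | i in [set i | (i < n.-1)%N]]) `<=` der G.
Proof.
move=> _ [[i [j [/andP[ij jn] ->]]]|[i ni <-]]; apply: derR;
  apply: kgen_in; rewrite Nn ltnS //.
  exact: ltn_trans jn.
by rewrite -nS; apply: ltnW; exact: ni.
Qed.

Lemma branch1n_sub_der : L `<=` der G.
Proof. by apply: normal_closure_min branch1n_gens_der _; exact: der_normal. Qed.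

Lemma branch1n_normal : G `<=` normaliser_of L.
Proof. exact: normal_closure_normal. Qed.

Lemma branch1n_comm_sigma i : (i < n.-1)%N -> L [~ c i.+1, c 0%N].
Proof. by move=> ni; apply: sub_normal_closure; right; exists i. Qed.

Lemma branch1n_comm i j : (i < j)%N -> (j < n)%N -> L [~ c i.+1, c j.+1].
Proof.
move=> ij jn; apply: sub_normal_closure; left; exists i, j.
by rewrite ij.
Qed.

(** These are a_1, ..., a_(n-1): by its definition, L contains their
    commutators with all generators. *)
Lemma branch1n_central i : (0 < i)%N -> (i < n)%N -> central_mod L (c i).
Proof.
case: i => // i _ ni; apply: central_mod_gens; first exact: branch1n_normal.
  by apply: kgen_in; rewrite Nn ltnW.
case=> [_|j jn]; first by apply: branch1n_comm_sigma; rewrite -ltnS nS.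
rewrite Nn ltnS in jn; have [ij|ji|->] := ltngtP i j.
- exact: branch1n_comm.
- by rewrite -invgR; apply: sgV; apply: branch1n_comm => //; exact: ltnW.
- by rewrite commgg; exact: sg1.
Qed.

Let comm_sigma m : (0 < m)%N -> (m < n)%N ->
  [~ c m.+1, c 0%N] = tpair (c m) (c m).
Proof.
move=> m0 mn; rewrite -invgR kgen0 (cS m0 mn) commR_sigma.
rewrite invg1 mul1g mulg1 kgenV ?Nn 1?ltnW // putV kgenV ?Nn 1?ltnW //.
by case: (s m).
Qed.

Let comm_sigma1 : [~ c 1%N, c 0%N] = put (s 0%N) (sigma * c n) (c n * sigma).
Proof.
have cnV : (c n)^-1 = c n by rewrite kgenV ?Nn.
by rewrite -invgR kgen0 c1 commR_sigma putV !invgM !invgK sigmaV cnV.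
Qed.

(** The commutator [a_n, sigma] is <<a_(n-1), a_(n-1)>>, which commutes with
    sigma and with a_n. *)
Lemma branch1n_last_central : central_mod L [~ c n, c 0%N].
Proof.
have n1n : (n.-1 < n)%N by rewrite nS.
have n1_gt0 : (0 < n.-1)%N by rewrite -ltnS nS.
have c2 := @kgen_sq n.-1; rewrite Nn in c2.
have E : [~ c n, c 0%N] = tpair (c n.-1) (c n.-1).
  by rewrite -{1}nS comm_sigma.
apply: central_mod_gens; first exact: branch1n_normal.
  by apply: sgR; apply: kgen_in; rewrite Nn.
move=> j jN; suff [//|->] : L [~ [~ c n, c 0%N], c j] \/
    [~ [~ c n, c 0%N], c j] = 1 by exact: sg1.
case: j jN => [|j] jN.
  by right; rewrite E kgen0; apply/eqP; rewrite -conjg_fix tpairJsigma.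
rewrite Nn ltnS in jN; have [jn|nj] := ltnP j.+1 n; last first.
  right; have -> : j.+1 = n by apply/eqP; rewrite eqn_leq jN nj.
  rewrite E -{3}nS (cS n1_gt0 n1n); apply/eqP/commgP; rewrite /commute.
  by case: (s n.-1); rewrite /put !tpairM mulg1 mul1g.
left; apply: central_mod_sym; first exact: branch1n_central.
by apply: sgR; apply: kgen_in; rewrite Nn.
Qed.

Lemma last_comm_sq : [~ c n, c 0%N] * [~ c n, c 0%N] = 1.
Proof.
have n1_gt0 : (0 < n.-1)%N by rewrite -ltnS nS.
have n1n : (n.-1 < n)%N by rewrite nS.
by rewrite -{1 2}nS comm_sigma // tpairM kgen_sq ?tpair1 // Nn ltnW.
Qed.

Lemma branch1n_sec_par x : L x -> sec_par n.-1 x = false.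
Proof.
move: x; apply: normal_closure_sec_par branch1n_gens_der _.
move=> _ [[i [j [/andP[ij jn] ->]]]|[i ni <-]].
  have iN : (i.+1 < N)%N by rewrite Nn ltnS; exact: ltn_trans jn.
  rewrite /sec_par plev_sec_comm (kgenS iN).
  by rewrite (@kgenS j) ?Nn ?ltnS // !act_put.
rewrite -invgR (parityV (@sec_par_parity _)) ?sec_par_comm ?N1n ?nS //.
- by rewrite gtn_eqF.
- by rewrite -nS ltnS ltnW.
by apply: derR; apply: kgen_in; rewrite Nn // ltnS -nS ltnW.
Qed.

(** All generators but sigma and a_n being central modulo L, G'/L is generated
    by [a_n, sigma]. The parity dual to a_(n-1) of its first section is 1, and
    the same parity vanishes on L. *)
Lemma branch1n_quotient :
  [/\ quot_isog (der G) L 'rV['Z_2]_1,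
      quot_gen_by (der G) L [set [~ c n, c 0%N]] & finite_index L G].
Proof.
have z0V : [~ c n, c 0%N] = [~ c 0%N, c n.-1.+1].
  by rewrite nS -[RHS]invgR; apply/esym/mulg1_eq; exact: last_comm_sq.
have Dz : der G [~ c n, c 0%N] by apply: derR; apply: kgen_in; rewrite Nn.
have := @der_mod L 1 (fun=> sec_par n.-1) (fun=> [~ c n, c 0%N]).
have -> : [set [~ c n, c 0%N] | _ in `I_1] = [set [~ c n, c 0%N]].
  by apply/seteqP; split=> [_ [_ _ <-]|_ ->] //; exists 0%N.
apply.
- exact: branch1n_sub_der.
- exact: branch1n_normal.
- by move=> _ _; exact: sec_par_parity.
- by move=> _ _; exact: branch1n_sec_par.
- by [].
- by move=> [|//] [|//] _ _; rewrite z0V sec_par_comm ?eqxx // N1n nS.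
- by move=> _ _; rewrite last_comm_sq; exact: sg1.
- by move=> _ _; exact: branch1n_last_central.
move=> i j ij jN; rewrite Nn ltnS in jN.
have nL := branch1n_normal.
have Gc l : (l <= n)%N -> G (c l) by move=> ln; apply: kgen_in; rewrite Nn.
have Gi : G (c i) by apply: Gc; exact: leq_trans (ltnW ij) jN.
have nR : normaliser_of L [~ c i, c j] by apply/nL/sgR => //; exact: Gc.
have [i0|i_gt0] := posnP i; last first.
  exists (fun=> false); rewrite bitprod0; apply/coset_eq1 => //.
  have [_] := branch1n_central i_gt0 (leq_trans ij jN); apply; exact: Gc.
have [jn|jn] := ltnP j n.
  exists (fun=> false); rewrite bitprod0; apply/coset_eq1 => //.
  by apply: central_mod_sym => //; apply: branch1n_central => //; rewrite -i0.
have {jn jN}-> : j = n by apply/eqP; rewrite eqn_leq jN.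
exists (fun=> true); rewrite /bitprod big_ord_recl big_ord0 mulg1 expg1.
by rewrite i0 z0V nS.
Qed.

(** For i < n, <<a_i, 1>> is conjugate to a_(i+1), which is central modulo L
    unless i = n-1. In this case the other entry of the commutator is sigma or
    a_n, both sections of a_1, and a_1 is central modulo L. *)
Lemma branch1n_prod_sub : M `<=` L.
Proof.
apply: geom_prod_sub; first by apply: branch1n_normal; exact: sigma_in.
have nL := branch1n_normal.
have key i j : (0 < i)%N -> (i < n)%N -> (j <= n)%N ->
    (i = n.-1 -> j = 0%N \/ j = n) -> left_factor L [~ c i, c j].
  move=> i0 ni jn hij; rewrite -[left_factor L _]/(L (tpair _ 1)).
  have iN : (i.+1 < N)%N by rewrite Nn.
  have Gi : G (tpair (c i) 1) by apply: kgen_pair; rewrite ?k1 ?gtn_eqF.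
  have [i_last|i_last] := eqVneq i n.-1; last first.
    have [h Gh] : exists h, G (tpair (c j) h).
      by apply: G_proj; apply: kgen_in; rewrite Nn.
    have -> : tpair [~ c i, c j] 1 = [~ tpair (c i) 1, tpair (c j) h].
      by have := putR false (c i) 1 (c j) h; rewrite comm1g.
    have -> : tpair (c i) 1 = c i.+1 ^ sigma ^+ (s i != false).
      by rewrite (cS i0 ni) put_move.
    have [] // : central_mod L (c i.+1 ^ sigma ^+ (s i != false)).
      apply: central_modJ => //; last by apply: sgX; exact: sigma_in.
      apply: branch1n_central => //.
      by rewrite ltn_neqAle ni andbT -nS eqSS.
    by move=> _; apply.
  have cc1 : central_mod L (c 1%N) by exact: branch1n_central.
  have [h] : exists h, exists e, tpair (c j) h = c 1%N ^ sigma ^+ (e : bool).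
    rewrite c1; case: (hij i_last) => ->; [exists (c n) | exists sigma].
      by exists (s 0%N != false); rewrite put_move kgen0.
    exists (s 0%N != true); rewrite put_move; by [].
  move=> [e he].
  have -> : tpair [~ c i, c j] 1 = [~ tpair (c i) 1, tpair (c j) h].
    by have := putR false (c i) 1 (c j) h; rewrite comm1g.
  rewrite he; apply: central_mod_sym => //; apply: central_modJ => //.
  by apply: sgX; exact: sigma_in.
apply: normal_closure_min; last exact: left_factor_normal.
move=> _ [[i [j [/andP[ij jn] ->]]]|[i ni <-]].
  apply: key => //; first exact: leq_ltn_trans ij jn.
  move=> i_last; right; apply/eqP; rewrite eqn_leq jn /=.
  by rewrite -[n in (n <= _)%N]nS -i_last.
by apply: key => //; [rewrite -nS ltnS | left].
Qed.

(** Of the generators that fix the first level, only a_1 has sections that are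
    not central modulo L, namely sigma and a_n. *)
Lemma kgen_central_sections j d : (0 < j)%N -> (j < n)%N ->
  central_mod L (sec (c j.+1) d).
Proof.
move=> j0 jn; rewrite (cS j0 jn) sec_put; case: ifP => _.
  exact: branch1n_central.
exact: central_mod1.
Qed.

Lemma branch1n_mod_normal : L `<=` normaliser_of M.
Proof.
move=> x /branch1n_sub_der/der_sub; apply: geom_prod_G_normal;
  exact: branch1n_normal.
Qed.

Local Notation gens := [set [~ c i.+1, c 0%N] | i in [set i | (i < n.-1)%N]].

(** Each generator of G centralises or inverts each [a_i, sigma] modulo L x L:
    sigma inverts all of them, a_1 inverts [a_1, sigma], and in all other
    cases the sections commute modulo L. So these commutators and L x L
    generate a normal subgroup of G. *)
Lemma branch1n_generated : L `<=` generated (gens `|` M).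
Proof.
set K := generated _; have nL := branch1n_normal.
have KM x : M x -> K x by move=> Mx; apply: sub_generated; right.
have Kg i : (i < n.-1)%N -> K [~ c i.+1, c 0%N].
  by move=> ni; apply: sub_generated; left; exists i.
have nK : G `<=` normaliser_of K.
  rewrite kneadingE; apply: generated_normaliser => _ [j jN <-].
  have {}jN : (j < N)%N := jN; have Gj := kgen_in jN.
  apply: involution_normaliser; first exact: kgen_sq.
  move=> y [[i ni <-]|My]; last by apply/KM/(geom_prod_G_normal nL Gj).
  have i1N : (i.+1 < N)%N by rewrite Nn ltnS -nS ltnS ltnW.
  have GR : G [~ c i.+1, c 0%N] by apply: sgR; apply: kgen_in => //; rewrite Nn.
  have aR : act [~ c i.+1, c 0%N] = false by apply: der_act; apply: derR;
    apply: kgen_in => //; rewrite Nn.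
  have viaM : M [~ [~ c i.+1, c 0%N], c j] -> K ([~ c i.+1, c 0%N] ^ c j).
    move=> MR; rewrite -[_ ^ _](mulVKg [~ c i.+1, c 0%N]).
    by apply: sgM; [exact: Kg | exact: KM].
  have inv l : (l < N)%N -> [~ c i.+1, c 0%N] ^ c l = [~ c i.+1, c 0%N]^-1 ->
      K ([~ c i.+1, c 0%N] ^ c l).
    by move=> _ ->; apply: sgV; exact: Kg.
  case: j jN Gj viaM => [|j] jN Gj viaM.
    by apply: inv => //; apply: involution_commJr; exact: kgen_sq.
  rewrite Nn ltnS in jN; have [j0|j_gt0] := posnP j; last first.
    apply: viaM; apply: geom_prod_comm_central => //.
      by rewrite (cS j_gt0 jN) act_put.
    by move=> d; exact: kgen_central_sections.
  rewrite j0 in viaM *; have [i0|i_gt0] := posnP i.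
    apply: inv; first by rewrite Nn ltnS ltnW.
    by rewrite i0; apply: involution_commJl; apply: kgen_sq;
      rewrite Nn ltnS ltnW.
  apply: viaM; have ni' : (i < n)%N by rewrite -nS ltnS ltnW.
  apply: geom_prod_comm => // [|d]; first by rewrite c1 act_put.
  rewrite comm_sigma // sec_pair; have [_ cc] := branch1n_central i_gt0 ni'.
  by rewrite if_same; apply: cc; apply: G_sec; apply: kgen_in;
    rewrite Nn ltnS ltnW.
apply: normal_closure_min => // _ [[i [j [/andP[ij jn] ->]]]|[i ni <-]].
  have i1N : (i.+1 < N)%N by rewrite Nn ltnS; exact: ltn_trans jn.
  have j0 : (0 < j)%N by exact: leq_ltn_trans ij.
  apply: KM; apply: geom_prod_comm_central; first exact: kgen_in.
  - by rewrite (kgenS i1N) act_put.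
  - by rewrite (cS j0 jn) act_put.
  by move=> d; exact: kgen_central_sections.
exact: Kg.
Qed.

Let tau j := [~ c j.+2, c 0%N].

Let tauE j : (j < n - 2)%N -> tau j = tpair (c j.+1) (c j.+1).
Proof. by move=> jn; rewrite /tau comm_sigma //; rewrite ltn_subRL in jn;
  rewrite -addn1 addnC ltnW. Qed.

Let tau_in j : (j < n - 2)%N -> L (tau j).
Proof.
move=> jn; apply: branch1n_comm_sigma.
by rewrite ltn_subRL in jn; rewrite -ltnS nS.
Qed.

Let chi_in : L [~ c 1%N, c 0%N].
Proof. by apply: branch1n_comm_sigma; rewrite -ltnS nS. Qed.

(** The parities of the first section give the u_j and the parity of i, and i
    = 2 is excluded by the character of G'/L. *)
Lemma branch1n_independent i u : (i < 4)%N ->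
  M ([~ c 1%N, c 0%N] ^+ i * bitprod (n - 2) tau u) ->
  i = 0%N /\ forall j, (j < n - 2)%N -> u j = false.
Proof.
move=> i4 Mx; have LD := branch1n_sub_der.
have M0 l x : M x -> sec_par l x = false.
  by move=> /geom_prodP[_ L0 _]; exact: parity_der (@plev_parity G l) (LD _ L0).
have D1 := LD _ chi_in.
have Dt j : (j < n - 2)%N -> der G (tau j) by move=> jn; exact/LD/tau_in.
have sgnE l m : (l < n)%N -> (m < n)%N ->
    sec_par l [~ c m.+1, c 0%N] = (l == m).
  move=> ln mn; rewrite -invgR (parityV (@sec_par_parity l)).
    by rewrite sec_par_comm // N1n.
  by apply: derR; apply: kgen_in; rewrite Nn.
have parE l : (l < n)%N ->
    sec_par l ([~ c 1%N, c 0%N] ^+ i * bitprod (n - 2) tau u) =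
    ((l == 0%N) && odd i) (+) ((0 < l)%N && (l.-1 < n - 2)%N && u l.-1).
  move=> ln; rewrite sec_par_parity; first congr addb.
  - elim: i {i4 Mx} => [|i IHi]; first by rewrite /sec_par sec1 plev1 andbF.
    rewrite expgS sec_par_parity ?IHi //; last exact: sgX.
    rewrite sgnE // ?(ltnW n_gt1) //=.
    by case: (l == 0%N); case: (odd i).
  - case: l ln => [|l] ln /=.
      rewrite (parity_bitprod _ (@sec_par_parity 0%N)) // big1 // => j _.
      have jn := ltn_ord j; rewrite ltn_subRL in jn.
      by rewrite /tau sgnE ?andbF //; first exact: ltnW.
    apply: (parity_bitprod_delta (j := l) _ (@sec_par_parity l.+1)) => // j jn.
    rewrite ltn_subRL in jn; rewrite /tau sgnE ?eqSS //; exact: ltnW.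
  - exact: sgX.
  - exact: bitprod_mem.
have u0 j : (j < n - 2)%N -> u j = false.
  move=> jn; have jn1 : (j.+1 < n)%N by rewrite ltn_subRL in jn; exact: ltnW.
  by have := parE _ jn1; rewrite M0 //= jn /= => <-.
split=> //; have := parE _ (ltnW n_gt1); rewrite M0 //= addbF.
case: i i4 Mx {parE} => [|[|[|[|//]]]] // _ Mx _.
move: Mx; rewrite (@eq_bitprod _ _ _ u (fun=> false)) // bitprod0 mulg1.
rewrite comm_sigma1 putX => /geom_prod_put[Lr _].
(* The square of sigma a_n is the commutator that generates G' modulo L. *)
have rE : (sigma * c n) ^+ 2 = [~ c 0%N, c n.-1.+1].
  by rewrite nS expg2 kgen0 /commg /conjg sigmaV kgenV ?Nn // !mulgA.
by have := branch1n_sec_par Lr; rewrite rE sec_par_comm ?N1n ?nS // eqxx.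
Qed.

Lemma branch1n_chi_power i : (i < 4)%N -> M ([~ c 1%N, c 0%N] ^+ i) -> i = 0%N.
Proof.
move=> i4 Mi; have [] := @branch1n_independent i (fun=> false) i4.
  by rewrite bitprod0 mulg1.
by [].
Qed.

Lemma branch1n_case :
  [/\ branch_on G L, quot_isog (der G) L 'Z_2,
      quot_gen_by (der G) L [set [~ c n, c 0%N]],
      quot_isog L M ('Z_4 * 'rV['Z_2]_(n - 2))%type &
      quot_gen_by L M gens /\
      (has_order (coset_proj M [~ c 1%N, c 0%N]) 4 /\
       forall i, (0 < i < n.-1)%N ->
         has_order (coset_proj M [~ c i.+1, c 0%N]) 2)].
Proof.
have [isog gen fin] := branch1n_quotient; have nL := branch1n_normal.
have nM := branch1n_mod_normal; have ML := branch1n_prod_sub.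
have nML : normal_in M L by split.
have gensL : gens `<=` L by move=> _ [i ni <-]; exact: branch1n_comm_sigma.
have Gc j : (j <= n)%N -> G (c j) by move=> jn; apply: kgen_in; rewrite Nn.
have GL x : L x -> G x by move=> /branch1n_sub_der/der_sub.
have cen j : (j < n - 2)%N -> central_mod L (c j.+1).
  by rewrite ltn_subRL => jn; apply: branch1n_central => //; exact: ltnW.
have tau_sq j : (j < n - 2)%N -> tau j * tau j = 1.
  move=> jn; rewrite tauE // tpairM kgen_sq ?tpair1 // Nn ltnS.
  by rewrite ltn_subRL in jn; exact/ltnW/ltnW.
have act_tau j : (j < n - 2)%N -> act (tau j) = false by move=> jn;
  rewrite tauE.
have sec_tau j d : (j < n - 2)%N -> sec (tau j) d = c j.+1.
  by move=> jn; rewrite tauE // sec_pair if_same.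
have commM x j : (j < n - 2)%N -> L x -> M [~ x, tau j].
  move=> jn Lx; apply: geom_prod_comm_central; first exact: GL.
  - exact/der_act/branch1n_sub_der.
  - exact: act_tau.
  by move=> d; rewrite sec_tau //; exact: cen.
have chi4 : [~ c 1%N, c 0%N] ^+ 4 = 1.
  have z2 := last_comm_sq; have cnV : (c n)^-1 = c n by rewrite kgenV ?Nn.
  rewrite /commg /conjg kgen0 sigmaV cnV in z2.
  rewrite comm_sigma1 putX; have -> : (c n * sigma) ^+ 4 = 1.
    by rewrite -z2 /= !expgS expg0 mulg1 !mulgA.
  have -> : (sigma * c n) ^+ 4 = ((c n * sigma) ^+ 4)^-1.
    by rewrite -expVgn invgM sigmaV cnV.
  have -> : (c n * sigma) ^+ 4 = 1 by rewrite -z2 /= !expgS expg0 mulg1 !mulgA.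
  by rewrite invg1 put11.
have M1 : M 1 by exact: sg1.
have LK := branch1n_generated.
split.
- split; last exact: fin.
  split=> //; exists [~ c 1%N, c 0%N]; first exact: chi_in.
  by move=> e; have := @branch1n_chi_power 1 erefl; rewrite expg1 e => /(_ M1).
- have [nNG iso] := isog; split=> //.
  apply: (isomorphic_trans (h := fun u : 'rV['Z_2]_1 => u ord0 ord0)) iso.
    by move=> p q; exact: mxE.
  exists (fun z => \row_(_ < 1) z)%R => [p|z]; last by rewrite mxE.
  by apply/rowP => j; rewrite mxE (ord1 j).
- exact: gen.
- apply: (@quot_isog_cyclic4 _ L M (n - 2) [~ c 1%N, c 0%N] tau) => //.
  + by rewrite chi4.
  + by move=> j jn; rewrite tau_sq.
  + by move=> j jn; apply: commM.
  + by move=> i j im jn; apply: commM => //; exact: tau_in.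
  + apply: (subset_trans LK); apply: generated_min => x [[i ni <-]|Mx];
      last first.
      by apply: sub_generated; right.
    apply: sub_generated; left; case: i ni => [|i] ni; first by left.
    right; exists i => //; rewrite /= ltn_subRL -nS ltnS in ni *; exact: ni.
  exact: branch1n_independent.
split; first exact: quot_gen_by_sub.
have nc x : L x -> normaliser_of M x by exact: nM.
split.
  split=> //; first by rewrite -cosetX ?chi4 ?coset1 //; exact: nc.
  move=> j /andP[j0 j4]; rewrite -cosetX; last exact: nc.
  move=> /coset_eq1 e; have := branch1n_chi_power j4.
  by move=> /(_ (e (nc _ (sgX _ chi_in)))) j00; rewrite j00 in j0.
move=> [//|i] /andP[_ ni]; have im : (i < n - 2)%N.
  by rewrite ltn_subRL -nS ltnS.
have ntau := nc _ (tau_in im); split=> //.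
  by rewrite expg2 -cosetM // tau_sq // coset1.
case=> [//|[|//]] _; rewrite expg1 => /coset_eq1 => /(_ ntau) Mt.
have [] := @branch1n_independent 0 (fun l => l == i) erefl.
  by rewrite bitprod_delta // mul1g.
by move=> _ /(_ i im); rewrite eqxx.
Qed.

End CaseOneMany.

(** * The case k = 2 and n = 1 *)

Section CaseTwoOne.
(** Here d = b_1 = sigma, b = b_2 and a = a_1. *)
Hypothesis k2 : k = 2%N.
Hypothesis n1 : size v = 1%N.

Local Notation d := (c 0%N).
Local Notation b := (c 1%N).
Local Notation a := (c 2%N).

Definition branch21_gen : treeAut := [~ d, b * a].
Definition branch21 : subgroup treeAut := normal_closure G [set branch21_gen].
Local Notation x := branch21_gen.
Local Notation L := branch21.
Local Notation M := (geom_prod L L).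

Let N3 : N = 3%N. Proof. by rewrite k2 n1. Qed.
Let dE : d = sigma. Proof. exact: kgen0. Qed.
Let bE : b = put (s 0%N) d 1. Proof. by rewrite kgenS ?N3 // k2. Qed.
Let aE : a = put (s 1%N) b a. Proof. by rewrite {1}kgenS N3 // k2. Qed.

Let Gc j : (j < 3)%N -> G (c j). Proof. by rewrite -N3; exact: kgen_in. Qed.
Let Gd : G d. Proof. exact: Gc. Qed.
Let Gb : G b. Proof. exact: Gc. Qed.
Let Ga : G a. Proof. exact: Gc. Qed.
Let dd : d * d = 1. Proof. by apply: kgen_sq; rewrite N3. Qed.
Let bb : b * b = 1. Proof. by apply: kgen_sq; rewrite N3. Qed.
Let aa : a * a = 1. Proof. by apply: kgen_sq; rewrite N3. Qed.
Let dV : d^-1 = d. Proof. exact: mulg1_eq. Qed.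
Let bV : b^-1 = b. Proof. exact: mulg1_eq. Qed.
Let aV : a^-1 = a. Proof. exact: mulg1_eq. Qed.
Let act_b : act b = false. Proof. by rewrite bE act_put. Qed.
Let act_a : act a = false. Proof. by rewrite aE act_put. Qed.
Let act_d : act d = true. Proof. by rewrite dE. Qed.

Let plevc l j : (l < 3)%N -> (j < 3)%N -> plev l (c j) = (l == j).
Proof. by rewrite -N3; exact: plev_kgen. Qed.

Let bE1 : exists p q, [/\ b = put (s 1%N) p q, p * q = d & q * p = d].
Proof.
rewrite bE; have [->|ne] := eqVneq (s 0%N) (s 1%N).
  by exists d, 1; rewrite mulg1 mul1g.
exists 1, d; rewrite mulg1 mul1g; split=> //.
by rewrite -putC; congr put; case: (s 0%N) (s 1%N) ne => -[].
Qed.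

Lemma branch21_gen_sections : x = put (s 1%N) (a * (d * b)) (b * (d * a)).
Proof.
have [p [q [eb pq qp]]] := bE1.
have -> : x = (a * b) ^ sigma * (b * a).
  by rewrite /branch21_gen commgEr invgM aV bV -dE.
have -> : b * a = put (s 1%N) (p * b) (q * a) by rewrite {1}eb {1}aE putM.
have -> : a * b = put (s 1%N) (b * p) (a * q) by rewrite {1}eb {1}aE putM.
by rewrite putJsigma putM -!mulgA [q * (p * _)]mulgA [p * (q * _)]mulgA pq qp.
Qed.

Lemma branch21_gen_conj_sections :
  x ^ a = put (s 1%N) (b * (a * d)) (a * (b * d)).
Proof.
rewrite branch21_gen_sections {3}aE putJ /conjg aV bV !mulgA.
by rewrite -[_ * b * b]mulgA bb -[_ * a * a]mulgA aa !mulg1.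
Qed.

Lemma branch21_sub_der : L `<=` der G.
Proof.
apply: normal_closure_min; last exact: der_normal.
by move=> _ ->; apply: derR => //; exact: sgM.
Qed.

Lemma branch21_normal : G `<=` normaliser_of L.
Proof. exact: normal_closure_normal. Qed.

Lemma branch21_gen_in : L x.
Proof. exact: sub_normal_closure. Qed.

Local Notation pi := (coset_proj L).
Local Notation D := (pi d).
Local Notation B := (pi b).
Local Notation A := (pi a).

Let piM g h : G g -> G h -> pi (g * h) = pi g * pi h.
Proof. by move=> Gg Gh; apply: cosetM; exact: branch21_normal. Qed.

Let piR g h : G g -> G h -> pi [~ g, h] = [~ pi g, pi h].
Proof. by move=> Gg Gh; apply: cosetR; exact: branch21_normal. Qed.

Let pi3 g h l : G g -> G h -> G l -> pi (g * (h * l)) = pi g * (pi h * pi l).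
Proof. by move=> Gg Gh Gl; rewrite !piM //; exact: sgM. Qed.

Let pi1 g : G g -> pi g = 1 <-> L g.
Proof. by move=> Gg; apply: coset_eq1; exact: branch21_normal. Qed.

Let DD : D * D = 1. Proof. by rewrite -piM // dd coset1. Qed.
Let BB : B * B = 1. Proof. by rewrite -piM // bb coset1. Qed.
Let AA : A * A = 1. Proof. by rewrite -piM // aa coset1. Qed.

Let comDC : commute D (B * A).
Proof.
apply/commgP; rewrite -piM // -piR //; last exact: sgM.
by apply/eqP/pi1; [apply: sgR => //; exact: sgM | exact: branch21_gen_in].
Qed.

Let com_db : commute d (d ^ b).
Proof.
have := disjoint_support (s 0%N) (s 0%N) d d.
rewrite eqxx expg1 -bE -dE /commute /conjg dV bV !mulgA.
by move=> ->.
Qed.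

Let comDV : commute D (D ^ B).
Proof.
rewrite -cosetJ; try exact: branch21_normal.
by rewrite /commute -!piM ?com_db //; exact: sgJ.
Qed.

Let db_sq : [~ d, b] * [~ d, b] = 1.
Proof. exact: (three_commDB_sq (V := d ^ b)). Qed.

Let C4 : (B * A) ^+ 4 = 1.
Proof.
apply: (three_involutions_C4 (D := D) (e := s 0%N != s 1%N)) => //.
have Gbd : G (b ^ d ^+ (s 0%N != s 1%N)) by apply: sgJ => //; exact: sgX.
rewrite -cosetX; try exact: branch21_normal.
rewrite -cosetJ; try (apply: branch21_normal => //; exact: sgX).
rewrite -piR // -piM; try exact: sgR.
have -> : b ^ d ^+ (s 0%N != s 1%N) = put (s 1%N) d 1.
  by have := put_move (s 0%N) (s 1%N) d 1; rewrite -bE -dE.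
have -> : [~ put (s 1%N) d 1, a] = put (s 1%N) [~ d, b] 1.
  by rewrite {1}aE putR comm1g.
by rewrite putM db_sq mulg1 put11 coset1.
Qed.

Let zD : commute D [~ D, B]. Proof. exact: (three_commDB_D (V := D ^ B)). Qed.
Let zB : commute B [~ D, B]. Proof. exact: (three_commDB_B (V := D ^ B)). Qed.
Let zA : commute A [~ D, B].
Proof. exact: (three_commDB_A (C := B * A) (V := D ^ B)). Qed.
Let DA : [~ D, A] = [~ D, B].
Proof. exact: (three_commDA (C := B * A) (V := D ^ B)). Qed.
Let tD : commute D [~ B, A]. Proof. exact: (three_commBA_D (C := B * A)). Qed.
Let tB : commute B [~ B, A]. Proof. exact: (three_commBA_B (C := B * A)). Qed.
Let tA : commute A [~ B, A]. Proof. exact: (three_commBA_A (C := B * A)). Qed.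
Let t_sq : [~ B, A] * [~ B, A] = 1.
Proof. exact: (three_commBA_sq (C := B * A)). Qed.

Let central3 u : G u -> commute D (pi u) -> commute B (pi u) ->
  commute A (pi u) -> central_mod L u.
Proof.
move=> Gu cD cB cA; apply: central_modE => //; first exact: branch21_normal.
by rewrite N3 => -[|[|[|//]]] _.
Qed.

Let db_central : central_mod L [~ d, b].
Proof. by apply: central3; rewrite ?piR //; exact: sgR. Qed.

Let da_central : central_mod L [~ d, a].
Proof. by apply: central3; rewrite ?piR ?DA //; exact: sgR. Qed.

Let ba_central : central_mod L [~ b, a].
Proof. by apply: central3; rewrite ?piR //; exact: sgR. Qed.

(** The two characters of G' with common kernel L. The second one measures
    the quotient of the two sections by means of the first. *)
Definition branch21_char1 g := sec_par 0%N g (+) sec_par 1%N g.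
Definition branch21_char2 g := branch21_char1 ((sec g false)^-1 * sec g true).

Let f1M : parity_on (der G) branch21_char1.
Proof.
move=> g h Dg Dh; rewrite /branch21_char1 !sec_par_parity //.
by case: (sec_par _ g) (sec_par _ h) (sec_par _ g) (sec_par _ h) => -[] [] [].
Qed.

Let f1J g h : der G g -> branch21_char1 (g ^ h) = branch21_char1 g.
Proof. by move=> Dg; rewrite /branch21_char1 !sec_parJ. Qed.

Lemma branch21_char1_comm g h : branch21_char1 [~ g, h] =
  (act h && (plev 1 g (+) plev 2 g)) (+) (act g && (plev 1 h (+) plev 2 h)).
Proof.
rewrite /branch21_char1 /sec_par !plev_sec_comm.
by case: (act g) (act h) (plev 1 g) (plev 2 g) (plev 1 h) (plev 2 h)
  => -[] [] [] [] [].
Qed.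

Lemma branch21_char1_sq g :
  branch21_char1 (g * g) = act g && (plev 1 g (+) plev 2 g).
Proof.
rewrite /branch21_char1 /sec_par !secM !plevM (plevS 0 g) (plevS 1 g) addFb.
case: (act g); last by rewrite !addbb.
by case: (plev 0 (sec g false)) (plev 0 (sec g true)) (plev 1 (sec g false))
  (plev 1 (sec g true)) => -[] [] [].
Qed.

Let Dsec g : der G g -> der G ((sec g false)^-1 * sec g true).
Proof.
move=> Dg; have Gs e : G (sec g e) by apply: G_sec; exact: der_sub.
apply/der_plev; split=> [|l _]; first by apply: sgM => //; exact: sgV.
by rewrite plevM plevV (der_sec _ true) // addbb.
Qed.

Let f2M : parity_on (der G) branch21_char2.
Proof.
move=> g h Dg Dh; rewrite /branch21_char2 !secM (der_act Dg) /=.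
set g0 := sec g false; set g1 := sec g true.
set h0 := sec h false; set h1 := sec h true.
have -> : (g0 * h0)^-1 * (g1 * h1) = (g0^-1 * g1) ^ h0 * (h0^-1 * h1).
  by rewrite invgM /conjg !mulgA mulgK.
have Dgs := Dsec Dg; rewrite f1M ?f1J //; last exact: Dsec.
by apply/der_normal => //; apply: G_sec; exact: der_sub.
Qed.

(** Conjugation by u changes the quotient of the two sections of g, up to
    conjugation, by the commutator of a section of g with a quotient of
    sections of u. The first character sees this commutator only through
    parities that cancel, by wrap_der for g and wrap_side for u. *)
Let f2J g u : der G g -> G u ->
  branch21_char2 (g ^ u) = branch21_char2 g.
Proof.
move=> Dg Gu; have ag := der_act Dg; rewrite /branch21_char2 !sec_conj //.
set e := false (+) act u; have -> : true (+) act u = ~~ e by rewrite /e;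
  case: act.
set p := sec g e; set q := sec g (~~ e).
set P := sec u e; set Q := sec u (~~ e).
have -> : (p ^ P)^-1 * q ^ Q = [~ p, Q * P^-1] ^ P * (p^-1 * q) ^ Q.
  by rewrite /commg /conjg !invgM !invgK !mulgA !(mulgVK, mulgK).
have Gs e' : G (sec g e') by apply: G_sec; exact: der_sub.
have Gu' e' : G (sec u e') by exact: G_sec.
have GQP : G (Q * P^-1) by apply: sgM; [exact: Gu' | apply: sgV; exact: Gu'].
have Dpq : der G (p^-1 * q).
  rewrite /p /q; case: e {P Q GQP p q} => /=; last exact: Dsec.
  by have := sgV (Dsec Dg); rewrite invgM invgK.
have DR : der G [~ p, Q * P^-1] by apply: derR => //; exact: Gs.
rewrite f1M; try by apply/(der_normal (Gu' _)).
rewrite !f1J // branch21_char1_comm.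
have plp l : plev l p = plev l (sec g false) by exact: der_sec.
have -> : plev 1 p (+) plev 2 p = false.
  have e12 : plev 2 (sec g false) = plev 1 (sec g false).
    by have := wrap_der Dg; rewrite N3 k2.
  by rewrite !plp e12 addbb.
have -> : plev 1 (Q * P^-1) (+) plev 2 (Q * P^-1) = false.
  have ePQ : plev 2 P (+) plev 1 P = plev 2 Q (+) plev 1 Q.
    have := wrap_side e Gu; rewrite -(wrap_side (~~ e) Gu) /wrap N3 k2.
    exact: id.
  rewrite !plevM !plevV; move: ePQ.
  by case: (plev 2 P) (plev 1 P) (plev 2 Q) (plev 1 Q) => -[] [] [].
rewrite !andbF /= /p /q; case: e {P Q GQP p q Dpq DR plp} => //=.
rewrite -(parityV f1M (x := (sec g false)^-1 * sec g true)) ?invgM ?invgK //.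
exact: Dsec.
Qed.

Lemma branch21_char1_x : branch21_char1 x = false.
Proof.
by rewrite branch21_char1_comm actM act_b act_a act_d !plevM !plevc.
Qed.

Lemma branch21_char2_x : branch21_char2 x = false.
Proof.
rewrite /branch21_char2 branch21_gen_sections !sec_put.
have f1_sq_word y : y = a * (d * b) \/ y = b * (d * a) -> branch21_char1 (y *
  y) = false.
  by case=> ->; rewrite branch21_char1_sq !actM !plevM act_b act_d act_a !plevc.
have eV : (a * (d * b))^-1 = b * (d * a) by rewrite !invgM aV bV dV mulgA.
have eV' : (b * (d * a))^-1 = a * (d * b) by rewrite -eV invgK.
by case: (s 1%N); rewrite /= ?eV ?eV'; apply: f1_sq_word; [left | right].
Qed.

Lemma branch21_charL y :
  L y -> branch21_char1 y = false /\ branch21_char2 y = false.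
Proof.
move: y; apply: generated_in_ind.
- by rewrite (parity1 f1M) (parity1 f2M).
- by move=> y z /branch21_sub_der Dy /branch21_sub_der Dz [e1 e2] [e3 e4];
    rewrite f1M ?f2M ?e1 ?e2 ?e3 ?e4.
- by move=> y /branch21_sub_der Dy [e1 e2]; rewrite (parityV f1M) ?(parityV
    f2M).
move=> _ [_ -> [g Gg <-]]; have Dx := branch21_sub_der branch21_gen_in.
by rewrite f1J ?f2J // ?branch21_char1_x ?branch21_char2_x.
Qed.

Let f2_put t g : der G g -> branch21_char2 (put t g 1) = branch21_char1 g.
Proof.
move=> Dg; rewrite /branch21_char2 !sec_put; case: t => /=;
  first by rewrite invg1 mul1g.
by rewrite mulg1 (parityV f1M).
Qed.

Let dual_e i := if i is 0%N then [~ d, b] else [~ b, a].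
Let dual_f i := if i is 0%N then branch21_char1 else branch21_char2.

Let f_db : branch21_char1 [~ d, b] = true /\ branch21_char2 [~ d, b] = false.
Proof.
split; first by rewrite branch21_char1_comm act_b act_d !plevc.
rewrite {1}dE bE commR_sigma invg1 mul1g mulg1 dV.
by rewrite /branch21_char2 !sec_put !if_same mulVg (parity1 f1M).
Qed.

Let f_ba : branch21_char1 [~ b, a] = false /\ branch21_char2 [~ b, a] = true.
Proof.
split; first by rewrite branch21_char1_comm act_b act_a.
have [y [Dy fy ->]] : exists y, [/\ der G y, branch21_char1 y = true &
    [~ b, a] = put (s 0%N) y 1].
  have [e|ne] := eqVneq (s 0%N) (s 1%N).
    exists [~ d, b]; split; [exact: derR | by have [] := f_db |].
    by rewrite {1}bE {1}aE -e putR comm1g.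
  exists [~ d, a]; split; first exact: derR.
    by rewrite branch21_char1_comm act_a act_d !plevc.
  have ea : a = put (s 0%N) a b.
    by rewrite {1}aE -putC; congr put; case: (s 0%N) (s 1%N) ne => -[].
  by rewrite {1}bE {1}ea putR comm1g.
by rewrite f2_put.
Qed.

Lemma branch21_quotient :
  [/\ quot_isog (der G) L 'rV['Z_2]_2,
      quot_gen_by (der G) L [set [~ d, b]; [~ b, a]] & finite_index L G].
Proof.
have [f10 f20] := f_db; have [f11 f21] := f_ba.
have -> : [set [~ d, b]; [~ b, a]] = [set dual_e i | i in `I_2].
  apply/seteqP; split=> [y []->|_ [i i2 <-]].
  - by exists 0%N.
  - by exists 1%N.
  by case: i i2 => [|[|//]] _; [left | right].
have Dx := branch21_sub_der; have nL := branch21_normal.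
apply: (@der_mod L 2 dual_f dual_e) => //.
- by case=> [|[|//]] _ /=.
- by case=> [|[|//]] _ y /branch21_charL[].
- by case=> [|[|//]] _; exact: derR.
- by case=> [|[|//]] [|[|//]] _ _ /=.
- case=> [|[|//]] _; first by rewrite [dual_e _ * _]db_sq; exact: sg1.
  apply/pi1; first by apply: sgM; exact: sgR.
  by rewrite piM ?piR //; exact: sgR.
- by case=> [|[|//]] _.
rewrite N3 => i j ij j3.
have bitE u : bitprod 2 (fun l => pi (dual_e l)) u =
    pi [~ d, b] ^+ u 0%N * pi [~ b, a] ^+ u 1%N.
  by rewrite /bitprod !big_ord_recl big_ord0 mulg1.
case: i j ij j3 => [|[|[|i]]] [|[|[|j]]] // _ _.
- by exists (fun l => l == 0%N); rewrite bitE /= expg1 mulg1.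
- by exists (fun l => l == 0%N); rewrite bitE /= expg1 mulg1 !piR ?DA.
- by exists (fun l => l == 1%N); rewrite bitE /= expg1 mul1g.
Qed.

(** The element whose sections are ba and ab is a commutator congruent to
    [b_1, b_2], hence central modulo L. *)
Lemma branch21_prod_sub : M `<=` L.
Proof.
have nL := branch21_normal; apply: geom_prod_sub; first by apply: nL;
  rewrite -dE.
apply: normal_closure_min; last exact: left_factor_normal.
move=> _ ->; rewrite -[left_factor L _]/(L (tpair _ 1)).
have Gd1 : G (tpair d 1).
  by apply: (@G_put (s 0%N)); rewrite -bE.
have [y cy ey] : exists2 y, central_mod L y & y = tpair (b * a) (a * b).
  have aJ : a ^ sigma = put (s 1%N) a b by rewrite {1}aE putJsigma.
  case: (s 1%N) aE aJ => ea aJ.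
    exists [~ d, a]; first exact: da_central.
    by rewrite commgEr aV dE aJ {2}ea /put tpairM.
  exists [~ a, d].
    by apply: central3; [exact: sgR | ..]; rewrite piR // -invgR;
      apply: commuteV; rewrite DA.
  by rewrite commgEl aV dE aJ {1}ea /put tpairM.
have -> : tpair x 1 = [~ tpair d 1, y].
  rewrite ey; have := putR false d 1 (b * a) (a * b).
  by rewrite comm1g.
by apply: central_mod_sym.
Qed.

Local Notation W1 := (a * (d * b)).
Local Notation W2 := (b * (d * a)).
Local Notation W3 := (b * (a * d)).
Local Notation W4 := (a * (b * d)).

Let GW1 : G W1. Proof. by do 2!apply: sgM => //. Qed.
Let GW2 : G W2. Proof. by do 2!apply: sgM => //. Qed.
Let GW3 : G W3. Proof. by do 2!apply: sgM => //. Qed.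
Let GW4 : G W4. Proof. by do 2!apply: sgM => //. Qed.

Let fourth_power_L g : G g -> pi g * pi g = [~ B, A] -> L (g ^+ 4).
Proof.
move=> Gg e; apply/pi1; first exact: sgX.
rewrite cosetX; last exact: branch21_normal.
by rewrite !expgS expg0 mulg1 mulgA e t_sq.
Qed.

Let W1_sq : pi W1 * pi W1 = [~ B, A].
Proof. by rewrite !pi3 //; exact: (three_ADB_sq (C := B * A) (V := D ^ B)). Qed.
Let W2_sq : pi W2 * pi W2 = [~ B, A].
Proof. by rewrite !pi3 //; exact: (three_BDA_sq (C := B * A) (V := D ^ B)). Qed.
Let W3_sq : pi W3 * pi W3 = [~ B, A].
Proof. by rewrite !pi3 //; exact: (three_BAD_sq (C := B * A)). Qed.
Let W4_sq : pi W4 * pi W4 = [~ B, A].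
Proof. by rewrite !pi3 //; exact: (three_ABD_sq (C := B * A)). Qed.
Let W13 : pi (W1 * W3) = [~ D, B].
Proof. by rewrite piM // !pi3 //; exact: (three_ADB_BAD (C := B * A) (V := D ^
  B)). Qed.
Let W24 : pi (W2 * W4) = [~ D, B].
Proof. by rewrite piM // !pi3 //; exact: (three_BDA_ABD (C := B * A) (V := D ^
  B)). Qed.
Let W43 : L (W4 * W3).
Proof.
apply/pi1; first exact: sgM.
by rewrite piM // !pi3 //; exact: (three_ABD_BAD (C := B * A)).
Qed.
Let W34 : L (W3 * W4).
Proof.
apply/pi1; first exact: sgM.
by rewrite piM // !pi3 //; exact: (three_BAD_ABD (C := B * A)).
Qed.

Let comm_d W : G W -> commute (pi W) D -> forall e, L [~ W, sec b e].
Proof.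
move=> GW cW e; rewrite bE sec_put; case: ifP => _; last by rewrite commg1;
  exact: sg1.
apply/pi1; first exact: sgR.
by rewrite piR //; apply/eqP/commgP.
Qed.

Let W1_d : commute (pi W1) D.
Proof. by rewrite pi3 //; exact: (three_ADB_D (C := B * A) (V := D ^ B)). Qed.
Let W2_d : commute (pi W2) D.
Proof. by rewrite pi3 //; exact: (three_BDA_D (C := B * A) (V := D ^ B)). Qed.
Let W3_d : commute (pi W3) D.
Proof. by rewrite pi3 //; exact: (three_BAD_D (C := B * A)). Qed.
Let W4_d : commute (pi W4) D.
Proof. by rewrite pi3 //; exact: (three_ABD_D (C := B * A)). Qed.

Let Gx : G x. Proof. exact/der_sub/branch21_sub_der/branch21_gen_in. Qed.

Let xa_in : L (x ^ a).
Proof. by apply/(branch21_normal Ga)/branch21_gen_in. Qed.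

Lemma branch21_mod_normal : L `<=` normaliser_of M.
Proof.
move=> y /branch21_sub_der/der_sub; apply: geom_prod_G_normal;
  exact: branch21_normal.
Qed.

(** Modulo L x L, d inverts x and x^a, b centralises both of them and a
    exchanges them. *)
Lemma branch21_generated : L `<=` generated ([set x; x ^ a] `|` M).
Proof.
set K := generated _; have nL := branch21_normal.
have KM y : M y -> K y by move=> My; apply: sub_generated; right.
have Kx : K x by apply: sub_generated; left; left.
have Kxa : K (x ^ a) by apply: sub_generated; left; right.
have commK y g : K y -> M [~ y, g] -> K (y ^ g).
  by move=> Ky My; rewrite -[_ ^ _](mulVKg y); apply: sgM => //; exact: KM.
suff nK : G `<=` normaliser_of K by apply: normal_closure_min => // _ ->.
rewrite kneadingE; apply: generated_normaliser => _ [j jN <-].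
have Gj := kgen_in jN; apply: involution_normaliser; first exact: kgen_sq.
move=> y [[->|->]|My]; last by apply/KM/(geom_prod_G_normal nL Gj).
  have {}jN : (j < 3)%N by rewrite -N3.
  case: j jN {Gj} => [|[|[|//]]] _ //.
    by have -> : x ^ d = x^-1; [exact: involution_commJl | exact: sgV].
  apply: commK => //; apply: geom_prod_comm => //.
    by rewrite branch21_gen_sections act_put.
  move=> e; rewrite branch21_gen_sections sec_put; case: ifP => _;
    by apply: comm_d.
have {}jN : (j < 3)%N by rewrite -N3.
case: j jN {Gj} => [|[|[|//]]] _.
- rewrite -[(x ^ a) ^ d](mulgK (x ^ a)); apply: sgM; last by apply: sgV.
  have eJ g h : put (s 1%N) g h ^ d = put (s 1%N) h g by rewrite dE putJsigma.
  by apply: KM; rewrite branch21_gen_conj_sections eJ putM; apply/geom_prod_put.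
- apply: commK => //; apply: geom_prod_comm => //.
    by rewrite branch21_gen_conj_sections act_put.
  move=> e; rewrite branch21_gen_conj_sections sec_put; case: ifP => _;
    by apply: comm_d.
by rewrite -conjgM aa conjg1.
Qed.

(** On the side s 1, the element has the section (adb)^i (adb bad)^u, which
    lies in L. Its parity on level 0 makes i even; then it is congruent to [b,
    a]^(i/2) [d, b]^u, on which the two characters are known. *)
Lemma branch21_independent i u : (i < 4)%N ->
  M (x ^+ i * bitprod 1 (fun=> x * x ^ a) u) ->
  i = 0%N /\ forall j, (j < 1)%N -> u j = false.
Proof.
move=> i4; have -> : bitprod 1 (fun=> x * x ^ a) u = (x * x ^ a) ^+ u 0%N.
  by rewrite /bitprod big_ord_recl big_ord0 mulg1.
rewrite branch21_gen_conj_sections branch21_gen_sections putM !putX putM =>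
  /geom_prod_put[Lw _].
have Gba : G [~ b, a] by exact: sgR.
have Gdb : G [~ d, b] by exact: sgR.
have G13 : G (W1 * W3) by exact: sgM.
have i_even : i = (i./2).*2.
  rewrite -[LHS]odd_double_half; suff -> : odd i = false by [].
  have w0 := parity_der (@plev_parity G 0%N) (branch21_sub_der Lw).
  have <- : plev 0 (W1 ^+ i) = odd i.
    elim: (i) => [|l IHl]; first exact: plev1.
    by rewrite expgS plevM IHl !plevM !plevc.
  rewrite -w0 plevM; suff -> : plev 0 ((W1 * W3) ^+ u 0%N) = false.
    by rewrite addbF.
  by case: (u 0%N); rewrite ?expg1 ?expg0 ?plev1 // !plevM !plevc.
have Lzt : L ([~ b, a] ^+ i./2 * [~ d, b] ^+ u 0%N).
  apply/pi1; first by apply: sgM; exact: sgX.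
  have <- : pi (W1 ^+ i * (W1 * W3) ^+ u 0%N) = 1.
    by apply/pi1 => //; apply: sgM; exact: sgX.
  have nL := branch21_normal.
  rewrite !piM; try exact: sgX.
  rewrite !cosetX; try exact: nL.
  rewrite W13 !piR // i_even doubleK -muln2 mulnC expgnA.
  by rewrite [_ ^+ 2]expg2 W1_sq.
have Db : der G [~ b, a] by exact: derR.
have Dd : der G [~ d, b] by exact: derR.
have [f10 f20] := f_db; have [f11 f21] := f_ba.
have [f1z f2z] := branch21_charL Lzt; move: f1z f2z {Lw Lzt} i_even.
case: i i4 => [|[|[|[|//]]]] //= _; rewrite ?expg0 ?mul1g ?expg1.
  case u0: (u 0%N); first by rewrite expg1 f10.
  by move=> _ _ _; split=> // -[|//] _.
rewrite f2M ?f21 //; last exact: sgX.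
by case: (u 0%N); rewrite ?expg0 ?expg1 ?f20 ?(parity1 f2M).
Qed.

Lemma branch21_case :
  [/\ branch_on G L, quot_isog (der G) L 'rV['Z_2]_2,
      quot_gen_by (der G) L [set [~ d, b]; [~ b, a]],
      quot_isog L M ('Z_4 * 'Z_2)%type &
      quot_gen_by L M [set x; x ^ a] /\
      [/\ coset_proj M x ^+ 4 = 1, coset_proj M (x ^ a) ^+ 4 = 1 &
          coset_proj M x ^+ 2 * coset_proj M ((x ^+ 2) ^ a) = 1]].
Proof.
have [isog gen fin] := branch21_quotient; have nL := branch21_normal.
have nM := branch21_mod_normal; have ML := branch21_prod_sub.
have nML : normal_in M L by split.
have Lx := branch21_gen_in.
have GL y : L y -> G y by move=> /branch21_sub_der/der_sub.
have Lz g : G g -> pi g = [~ D, B] -> L (g * g).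
  move=> Gg e; apply/pi1; first exact: sgM.
  by rewrite piM // e -piR // -piM ?db_sq ?coset1 //; exact: sgR.
have cz g h : G g -> G h -> pi h = [~ D, B] -> L [~ g, h].
  move=> Gg Gh e; apply/pi1; first exact: sgR.
  rewrite piR // e -piR //; apply/eqP/commgP/commute_sym.
  by apply: central_mod_commute.
have G13 : G (W1 * W3) by exact: sgM.
have G24 : G (W2 * W4) by exact: sgM.
have x4 : M (x ^+ 4).
  by rewrite branch21_gen_sections putX; apply/geom_prod_put; split;
    apply: fourth_power_L.
have y0E : x * x ^ a = put (s 1%N) (W1 * W3) (W2 * W4).
  by rewrite branch21_gen_conj_sections branch21_gen_sections putM.
have nc y : L y -> normaliser_of M y by exact: nM.
have Mpi y : M y -> coset_proj M y = 1 by move=> My; apply/coset_eq1 => //;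
  exact/nc/ML.
split.
- split; last exact: fin.
  split=> //; exists x => // e; have := @branch21_independent 1 (fun=> false)
    erefl.
  by rewrite bitprod0 mulg1 expg1 e => -[] //; exact: sg1.
- exact: isog.
- exact: gen.
- have iso : quot_isog L M ('Z_4 * 'rV['Z_2]_1)%type.
    apply: (@quot_isog_cyclic4 _ L M 1 x (fun=> x * x ^ a)) => //.
    + by move=> _ _; exact: sgM.
    + by move=> _ _; rewrite y0E putM; apply/geom_prod_put; split; exact: Lz.
    + move=> _ _; rewrite y0E branch21_gen_sections putR.
      by apply/geom_prod_put; split; apply: cz.
    + by move=> *; rewrite commgg; exact: sg1.
    + apply: (subset_trans branch21_generated).
      set S := _ `|` M; have Sx : generated S x by apply: sub_generated; left;
        left.
      apply: generated_min => y [[->|->]|My] //.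
        rewrite -[x ^ a](mulKg x); apply: sgM; first exact: sgV.
        by apply: sub_generated; left; right; exists 0%N.
      by apply: sub_generated; right.
    exact: branch21_independent.
  have [_ iso'] := iso; split=> //.
  apply: (isomorphic_trans
    (h := fun q : 'Z_4 * 'rV['Z_2]_1 => (q.1, q.2 ord0 ord0))) iso'.
    by move=> p q; congr (_, _); exact: mxE.
  exists (fun q => (q.1, \row_(_ < 1) q.2)%R) => [[i p]|[i z]]; congr (_, _).
    by apply/rowP => j; rewrite mxE (ord1 j).
  exact: mxE.
split.
  apply: quot_gen_by_sub => //; last exact: branch21_generated.
  by move=> _ [->|->].
split.
- by rewrite -cosetX ?Mpi //; exact: nc.
- rewrite -cosetX ?Mpi //; last exact: nc.
  rewrite -conjXg; apply/(geom_prod_G_normal nL Ga); exact: x4.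
rewrite -cosetX; last exact: nc.
rewrite -cosetM; try exact: nc; first last.
- by apply: nc; apply/(nL _ Ga)/sgX.
- by apply: nc; exact: sgX.
apply: Mpi; rewrite conjXg branch21_gen_conj_sections branch21_gen_sections
  !putX putM.
have sq U W : G U -> G W -> pi U * pi U = [~ B, A] ->
    pi W * pi W = [~ B, A] -> L (U ^+ 2 * W ^+ 2).
  move=> GU GW eU eW; rewrite !expg2; apply/pi1; first by do 2?apply: sgM.
  by rewrite !piM ?eU ?eW ?t_sq //; exact: sgM.
by apply/geom_prod_put; split; exact: sq.
Qed.

End CaseTwoOne.

(** * The case k = n = 1 *)

Section CaseOneOne.
Hypothesis k1 : k = 1%N.
Hypothesis n1 : size v = 1%N.

Local Notation a := (c 1%N).
Local Notation r := (sigma * a).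

Let N2 : N = 2%N. Proof. by rewrite k1 n1. Qed.
Let aE : a = put (s 0%N) sigma a.
Proof. by rewrite {1}kgenS N2 // k1 kgen0. Qed.
Let aa : a * a = 1. Proof. by apply: kgen_sq; rewrite N2. Qed.
Let aV : a^-1 = a. Proof. exact: mulg1_eq. Qed.
Let Ga : G a. Proof. by apply: kgen_in; rewrite N2. Qed.
Let Gr : G r. Proof. by apply: sgM => //; exact: sigma_in. Qed.
Let rV : r^-1 = a * sigma. Proof. by rewrite invgM aV sigmaV. Qed.

Let r_even i : r ^+ i.*2 = put (s 0%N) (r^-1 ^+ i) (r ^+ i).
Proof.
have aJ : a ^ sigma = put (s 0%N) a sigma by rewrite {1}aE putJsigma.
have rr : r ^+ 2 = put (s 0%N) r^-1 r.
  have -> : r ^+ 2 = a ^ sigma * a by rewrite expg2 /conjg sigmaV !mulgA.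
  by rewrite aJ {2}aE putM rV.
by rewrite -mul2n expgnA rr putX.
Qed.

Let plev_r j : plev 1 (r ^+ j) = odd j.
Proof.
elim: j => [|j IHj]; first exact: plev1.
rewrite expgS plevM IHj plevM -kgen0 !plev_kgen ?N2 //.
Qed.

(** If r^j = 1, then j is even by a parity, and r^(j/2) is a section of r^j. *)
Lemma rotation_infinite j : r ^+ j = 1 -> j = 0%N.
Proof.
elim/ltn_ind: j => j IHj rj; have := plev_r j; rewrite rj plev1 => /esym oj.
have jE : j = j./2.*2 by rewrite -[LHS]odd_double_half oj.
have [j0|j_gt0] := posnP j; first by [].
have : put (s 0%N) (r^-1 ^+ j./2) (r ^+ j./2) = put (s 0%N) 1 1.
  by rewrite -r_even -jE rj put11.
move=> /(congr1 (fun g => sec g (~~ s 0%N))).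
rewrite !sec_put; have -> : (~~ s 0%N == s 0%N) = false by case: (s 0%N).
move=> /IHj j0; rewrite jE j0 //.
by rewrite -divn2 ltn_Pdiv.
Qed.

Definition dihedral_elt (q : dihedral_infty) : treeAut :=
  zexpg r q.1 * sigma ^+ q.2.

Lemma dihedral_eltM : {morph dihedral_elt : p q / p * q}.
Proof.
have rJ (e : bool) m : sigma ^+ e * zexpg r m = zexpg r ((-1) ^+ e * m)%R *
  sigma ^+ e.
  case: e; last by rewrite expg0 mul1g mulg1 GRing.expr0 GRing.mul1r.
  rewrite GRing.expr1 GRing.mulN1r zexpgN -zexpVg rV expg1.
  have -> : a * sigma = r ^ sigma by rewrite /conjg sigmaV !mulgA sigma_sq
    mul1g.
  by rewrite zexpgJ /conjg sigmaV -!mulgA sigma_sq mulg1.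
move=> [m e] [l f]; rewrite /dihedral_elt /= zexpgD -!mulgA; congr (_ * _).
rewrite mulgA rJ -mulgA; congr (_ * _).
by case: e f => -[]; rewrite /= ?expg0 ?expg1 ?mul1g ?mulg1 ?sigma_sq.
Qed.

Lemma dihedral_elt_range : G = range dihedral_elt :> set treeAut.
Proof.
have h1 : dihedral_elt 1 = 1 by rewrite /dihedral_elt /= mulg1.
apply/seteqP; split=> [g|_ [[m e] _ <-]]; last first.
  by apply: sgM; [exact: sg_zexpg | apply: sgX; exact: sigma_in].
suff H : G g -> exists q, dihedral_elt q = g by move=> /H[q <-]; exists q.
move: g; apply: kneading_ind.
- by exists 1.
- by move=> x y _ _ [p <-] [q <-]; exists (p * q); rewrite dihedral_eltM.
- move=> x _ [p <-]; exists p^-1; apply/esym/mulg1_eq.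
  by rewrite -dihedral_eltM mulgV.
rewrite N2 => -[|[|//]] _.
  by exists ((0 : int), true); rewrite /dihedral_elt /= mul1g expg1 kgen0.
exists ((-1)%R, true); rewrite /dihedral_elt -[(-1)%R]/(Negz 0) /= expg1 rV.
by rewrite -mulgA sigma_sq mulg1.
Qed.

Let zexpg_r m : exists2 j, zexpg r m = r ^+ j \/ zexpg r m = r ^- j &
  j = 0%N -> m = 0%R.
Proof.
by case: m => j; [exists j; [left | move=> ->] | exists j.+1; [right |]].
Qed.

Lemma dihedral_elt_inj q : dihedral_elt q = 1 -> q = 1.
Proof.
case: q => m e; rewrite /dihedral_elt /= => h1; have [j hj m0] := zexpg_r m.
have plevz l : plev l (zexpg r m) = plev l (r ^+ j).
  by case: hj => ->; rewrite ?plevV.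
have plev_e l : plev l (sigma ^+ e) = e && (l == 0%N).
  case: e {h1}; last by rewrite expg0 plev1.
  by rewrite expg1; case: l => // l; rewrite plevS !sec_sigma !plev1.
have oj : odd j = false.
  by have := congr1 (plev 1) h1; rewrite plevM plevz plev_r plev_e andbF addbF
    plev1.
have e0 : e = false.
  have : plev 0 (r ^+ j) = odd j.
    elim: (j) => [|i IHi]; first exact: plev1.
    by rewrite expgS plevM IHi plevM -kgen0 !plev_kgen ?N2.
  by have := congr1 (plev 0) h1; rewrite plevM plevz plev_e andbT plev1 oj =>
    /[swap] ->.
rewrite e0 expg0 mulg1 in h1 *; rewrite m0 //; apply: rotation_infinite.
by case: hj => hj; rewrite hj in h1 => //; apply/eqP; rewrite -invg_eq1 h1.
Qed.

(** The parities of this element make it an even power of r, and the sections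
    of r^(2i) are r^-i and r^i. *)
Lemma one_one_rigid t g : G (put t g 1) -> g = 1.
Proof.
move=> Gw; have even_power u h i : put u h 1 = r ^+ i.*2 -> h = 1.
  move=> e; have i0 : i = 0%N.
    apply: rotation_infinite.
    have := congr1 (fun g => sec g (~~ u)) e.
    rewrite r_even !sec_put; have -> : (~~ u == u) = false by case: u {e}.
    by case: ifP => _; [rewrite expVgn => /esym/eqP;
      rewrite invg_eq1 => /eqP | move=> ->].
  have := congr1 (fun g => sec g u) e.
  by rewrite i0 expg0 sec_put sec1 eqxx.
have [[m e] _ ew] : range dihedral_elt (put t g 1) by rewrite
  -dihedral_elt_range.
have [j hj _] := zexpg_r m; rewrite /dihedral_elt /= in ew.
have wrap_sigma : wrap sigma false = false by rewrite /wrap !sec_sigma !plev1.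
have wrap_r i : wrap (r ^+ i) false = odd i.
  elim: i => [|i IHi]; first by rewrite /wrap sec1 !plev1.
  have Gri : G (r ^+ i) by exact: sgX.
  rewrite expgS wrap_parity // IHi wrap_parity ?wrap_sigma //;
    last exact: sigma_in.
  rewrite aE /wrap sec_put N2 k1.
  by case: ifP => _; rewrite -?kgen0 !plev_kgen ?N2.
have wj : wrap (zexpg r m) false = odd j.
  by case: hj => ->; rewrite -?wrap_r ?(parityV wrap_parity) //; exact: sgX.
have w0 : wrap (put t g 1) false = false.
  have := wrap_side (~~ t) Gw; rewrite -(wrap_side true Gw) => <-.
  rewrite /wrap !sec_put; have -> : (~~ t == t) = false by case: (t).
  by rewrite !plev1.
have Gz : G (zexpg r m) by exact: sg_zexpg.
have Ge : G (sigma ^+ e) by apply: sgX; exact: sigma_in.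
have oj : odd j = false.
  rewrite -w0 -ew wrap_parity // wj.
  by case: (e); rewrite ?expg1 ?expg0 ?wrap_sigma ?(parity1 wrap_parity) addbF.
have plev_r0 i : plev 0 (r ^+ i) = odd i.
  elim: i => [|i IHi]; first exact: plev1.
  by rewrite expgS plevM IHi plevM -kgen0 !plev_kgen ?N2.
have e0 : e = false.
  have : plev 0 (put t g 1) = false by exact: act_put.
  rewrite -ew plevM; have -> : plev 0 (zexpg r m) = odd j.
    by case: hj => ->; rewrite ?plevV plev_r0.
  by rewrite oj; case: (e).
rewrite e0 expg0 mulg1 in ew.
have jE : j = j./2.*2 by rewrite -[LHS]odd_double_half oj.
case: hj => hj; rewrite hj jE in ew; first exact: even_power (esym ew).
apply: invg_inj; rewrite invg1; apply: (even_power t _ j./2).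
by rewrite -[r ^+ _]invgK ew putV invg1.
Qed.

Lemma one_one_case : isomorphic G dihedral_infty /\ ~ weakly_branch G.
Proof.
split.
  apply: (@isomorphic_into _ _ _ dihedral_elt); first exact: dihedral_eltM.
    exact: dihedral_elt_inj.
  exact: dihedral_elt_range.
move=> [H [HG [h Hh h1] HH]]; apply: h1; apply: (@one_one_rigid false).
by apply/HG/HH; exists h => //; exists 1; [exact: sg1 |].
Qed.

End CaseOneOne.

End Kneading.

(** * The theorem *)

Theorem theorem4p10 (w v : seq bool)
    (w_neq0 : w != [::]) (v_neq0 : v != [::])
    (yk_neq_xn : last false w != last false v) :
  let k := size w in let n := size v in
  let b := kb w in let a := ka w v in
  let G := kneading w v in
  [/\ ((2 <= k)%N /\ (2 <= n)%N) \/ ((3 <= k)%N /\ n = 1%N) ->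
      let G' := der G in
      [/\ branch_on G G',
          quot_isog G G' 'rV['Z_2]_(k + n),
          quot_gen_by G G' (kneading_gens w v),
          quot_isog G' (geom_prod G' G') 'rV['Z_2]_(k + n).-1 &
          quot_gen_by G' (geom_prod G' G')
            ([set [~ b 0%N, b j] | j in [set j | (0 < j < k)%N]] `|`
             [set [~ b 0%N, a i] | i in [set i | (i < n)%N]])],
      k = 2%N /\ n = 1%N ->
      let x := [~ b 0%N, b 1%N * a 0%N] in
      let L := normal_closure G [set x] in
      let p := coset_proj (geom_prod L L) in
      [/\ branch_on G L,
          quot_isog (der G) L 'rV['Z_2]_2,
          quot_gen_by (der G) L
            [set [~ b 0%N, b 1%N]; [~ b 1%N, a 0%N]],
          quot_isog L (geom_prod L L) ('Z_4 * 'Z_2)%type &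
          quot_gen_by L (geom_prod L L) [set x; x ^ a 0%N] /\
          [/\ p x ^+ 4 = 1, p (x ^ a 0%N) ^+ 4 = 1 &
              p x ^+ 2 * p ((x ^+ 2) ^ a 0%N) = 1]],
      k = 1%N /\ (2 <= n)%N ->
      let L := normal_closure G
        ([set g | exists i j, (i < j < n)%N /\ g = [~ a i, a j]] `|`
         [set [~ a i, b 0%N] | i in [set i | (i < n.-1)%N]]) in
      let p := coset_proj (geom_prod L L) in
      [/\ branch_on G L,
          quot_isog (der G) L 'Z_2,
          quot_gen_by (der G) L [set [~ a n.-1, b 0%N]],
          quot_isog L (geom_prod L L) ('Z_4 * 'rV['Z_2]_(n - 2))%type &
          quot_gen_by L (geom_prod L L)
            [set [~ a i, b 0%N] | i in [set i | (i < n.-1)%N]] /\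
          (has_order (p [~ a 0%N, b 0%N]) 4 /\
           forall i, (0 < i < n.-1)%N -> has_order (p [~ a i, b 0%N]) 2)] &
      k = 1%N /\ n = 1%N ->
      isomorphic G dihedral_infty /\ ~ weakly_branch G].
Proof.
move=> k n b a G.
have bE j : (j < k)%N -> b j = kgen w v j by rewrite /kgen => ->.
have aE i : a i = kgen w v (k + i) by rewrite /kgen ltnNge leq_addr addKn.
have k_gt0 : (0 < k)%N by rewrite lt0n size_eq0.
have b0 : b 0%N = kgen w v 0 by exact: bE.
split.
- move=> hkn G'.
  have [br [iso gen] [iso' gen']] := der_case w_neq0 v_neq0 yk_neq_xn hkn.
  split=> //; first by rewrite kneading_gensE.
  suff -> : [set [~ b 0%N, b j] | j in [set j | (0 < j < k)%N]] `|`
       [set [~ b 0%N, a i] | i in [set i | (i < n)%N]] =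
     [set [~ kgen w v 0, kgen w v m.+1] | m in `I_(size w + size v).-1] by [].
  have NE : (k + n = (k + n).-1.+1)%N by rewrite prednK // addn_gt0 k_gt0.
  apply/seteqP; split=> [_ [[[//|j] /andP[_ jk] <-]|[i ni <-]]|_ [m mN <-]].
  + exists j; last by rewrite b0 bE.
    by rewrite /= -ltnS -NE; exact: ltn_addr.
  + exists (k + i).-1; rewrite /= ?prednK ?addn_gt0 ?k_gt0 // ?b0 ?aE //.
    by rewrite -ltnS -NE ltn_add2l.
  rewrite -b0; have [mk|km] := ltnP m.+1 k.
    by left; exists m.+1; rewrite ?bE.
  right; exists (m.+1 - k)%N; last by rewrite aE subnKC.
  by rewrite /= ltn_subLR // NE ltnS.
- move=> [k2 n1] x L p.
  have b1 : b 1%N = kgen w v 1 by apply: bE; rewrite k2.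
  have a0 : a 0%N = kgen w v 2 by rewrite aE k2.
  have := branch21_case w_neq0 v_neq0 yk_neq_xn k2 n1.
  by rewrite /branch21 /branch21_gen -b0 -b1 -a0.
- move=> [k1 n2].
  have -> : a = (fun i => kgen w v i.+1) by apply/funext => i; rewrite aE k1.
  rewrite b0 prednK; last exact: ltnW.
  exact: branch1n_case.
by move=> [k1 n1]; exact: one_one_case.
Qed.
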